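(* The optimal constant in Ax's theorem is $\frac{1}{p-1}$. That is, the smallest real number $c$ with the following property is $c = \frac{1}{p-1}$: for every $x \in C$ and every $A \in \mathbb{R}$ such that $v(\sigma x - x) \geq A$ for all $\sigma \in G$, there exists $y \in K$ such that $v(x-y) \geq A - c$.
   Context: Let $p$ be a prime number, $k$ a perfect field of characteristic $p$, $F = \mathrm{Frac}\, W(k)$ the fraction field of the ring of Witt vectors of $k$, and $K$ a finite totally ramified extension of $F$. Let $\bar{K}$ be an algebraic closure of $K$ and $C$ the completion of $\bar{K}$ for the valuation $v$ extending that of $F$, normalized by $v(p)=1$ (with $v(0)=+\infty$); $v$ is extended to $C$. Let $G = \mathrm{Gal}(\bar{K}/K)$, acting on $C$ by continuity. Ax's theorem states that the property in the claim holds with $c = \frac{p}{(p-1)^2}$. *)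

(* Defs.v *)
From HB Require Import structures.
From mathcomp Require Import all_boot all_order all_algebra all_field.
From mathcomp Require Import boolp reals constructive_ereal.
From mathcomp Require mpoly.

Set Implicit Arguments.
Unset Strict Implicit.
Unset Printing Implicit Defensive.

Import Order.TTheory GRing.Theory Num.Theory.
Local Open Scope ring_scope.

(* The n-th Witt polynomial, evaluated at u:
   u_0^(p^n) + p u_1^(p^(n-1)) + ... + p^n u_n. *)
Definition ghost (p : nat) (A : comNzRingType) (u : nat -> A) (n : nat) : A :=
  \sum_(i < n.+1) (p ^ i)%:R * u i ^+ (p ^ (n - i)).

(* An integral polynomial in X_0, ..., X_n, Y_0, ..., Y_n, evaluated at
   X = a and Y = b: the first n.+1 variables are the X's. *)
Definition eval_law (A : comNzRingType) (n : nat)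
    (S : mpoly.mpoly (n.+1 + n.+1) int) (a b : nat -> A) : A :=
  mpoly.mmap intr
    (fun i => match split i with inl j => a j | inr j => b j end) S.

(* S is the sequence of polynomials through which the operation op on ghost
   components is expressed on Witt components. Such a sequence is unique, and
   it exists for op = + and op = * by Witt's theorem. *)
Definition is_witt_law (p : nat) (op : forall A : comNzRingType, A -> A -> A)
    (S : forall n, mpoly.mpoly (n.+1 + n.+1) int) : Prop :=
  forall (A : comNzRingType) (a b : nat -> A) (n : nat),
    ghost p (fun i => eval_law (S i) a b) n = op A (ghost p a n) (ghost p b n).

(* W, with Witt components coord, is the ring of p-typical Witt vectors of k:
   W is in bijection with k^nat, with sum and product given by the universal
   Witt polynomials. *)
Record is_witt_ring (p : nat) (k W : comNzRingType) (coord : W -> nat -> k) :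
    Prop := IsWittRing {
  witt_inj : forall w w', (forall n, coord w n = coord w' n) -> w = w';
  witt_surj : forall u : nat -> k, exists w, forall n, coord w n = u n;
  wittD : exists2 S, is_witt_law p (fun A => @GRing.add A) S &
    forall w w' n, coord (w + w') n = eval_law (S n) (coord w) (coord w');
  wittM : exists2 P, is_witt_law p (fun A => @GRing.mul A) P &
    forall w w' n, coord (w * w') n = eval_law (P n) (coord w) (coord w')
}.

Definition perfect_field (p : nat) (k : fieldType) : Prop :=
  p \in [pchar k] /\ forall x : k, exists y : k, y ^+ p = x.

Record is_valuation (R : realType) (L : fieldType) (v : L -> \bar R) : Prop :=
  IsValuation {
  valuation_infty : forall x, v x = +oo%E <-> x = 0;
  valuation_gtNy : forall x, (-oo < v x)%E;
  valuationM : forall x y, v (x * y)%R = (v x + v y)%E;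
  valuationD : forall x y, (Order.min (v x) (v y) <= v (x + y)%R)%E
}.

(* The valuation of Frac W, for a discrete valuation ring W in which p
   generates the maximal ideal: its valuation ring is W, and v(p) = 1. *)
Definition is_padic_valuation (R : realType) (p : nat) (W : idomainType)
    (v : {fraction W} -> \bar R) : Prop :=
  [/\ is_valuation v, v p%:R = 1%:E &
      forall a, (0%:E <= v a)%E <-> exists w : W, a = tofrac w].

(* Residue degree one. For a finite extension L of a complete discretely
   valued field F this amounts to e = [L : F]. *)
Definition totally_ramified (R : realType) (F : fieldType)
    (L : fieldExtType F) (v : L -> \bar R) : Prop :=
  forall x : L, (0%:E <= v x)%E -> exists a : F, (0%:E < v (x - a%:A)%R)%E.

Definition val_cauchy (R : realType) (L : fieldType) (v : L -> \bar R)
    (u : nat -> L) : Prop :=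
  forall A : R, exists N : nat, forall m n : nat,
    (N <= m)%N -> (N <= n)%N -> (A%:E <= v (u m - u n)%R)%E.

Definition val_cvg (R : realType) (L : fieldType) (v : L -> \bar R)
    (u : nat -> L) (l : L) : Prop :=
  forall A : R, exists N : nat, forall n : nat,
    (N <= n)%N -> (A%:E <= v (u n - l)%R)%E.

Definition val_continuous (R : realType) (L : fieldType) (v : L -> \bar R)
    (f : L -> L) : Prop :=
  forall (x : L) (A : R), exists B : R, forall y : L,
    (B%:E <= v (y - x)%R)%E -> (A%:E <= v (f y - f x)%R)%E.

(* (C, v) is the completion of L, embedded by j, for the valuation v \o j. *)
Record is_completion (R : realType) (L C : fieldType) (j : {rmorphism L -> C})
    (v : C -> \bar R) : Prop := IsCompletion {
  compl_val : is_valuation v;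
  compl_dense : forall (x : C) (A : R), exists z : L, (A%:E <= v (x - j z)%R)%E;
  compl_complete : forall u, val_cauchy v u -> exists l, val_cvg v u l
}.

Record field_aut (K L : fieldType) (i : {rmorphism K -> L}) : Type := FieldAut {
  aut_fun :> {rmorphism L -> L};
  aut_bij : bijective aut_fun;
  aut_fix : forall x : K, aut_fun (i x) = i x
}.

(* Density of j(L) makes act s the unique continuous extension of s to C. *)
Definition acts_by_continuity (R : realType) (K L C : fieldType)
    (i : {rmorphism K -> L}) (j : {rmorphism L -> C}) (v : C -> \bar R)
    (act : field_aut i -> C -> C) : Prop :=
  forall s : field_aut i,
    val_continuous v (act s) /\ forall z : L, act s (j z) = j (s z).

Definition ax_property (R : realType) (K L C : fieldType)
    (i : {rmorphism K -> L}) (j : {rmorphism L -> C}) (v : C -> \bar R)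
    (act : field_aut i -> C -> C) (c : R) : Prop :=
  forall (x : C) (A : R),
    (forall s : field_aut i, (A%:E <= v (act s x - x)%R)%E) ->
    exists y : K, ((A - c)%:E <= v (x - j (i y))%R)%E.

(* Main.v *)
Require Import Defs.
From HB Require Import structures.
From mathcomp Require Import all_boot all_order all_algebra all_field.
From mathcomp Require Import boolp reals constructive_ereal.
From mathcomp Require mpoly.
From mathcomp Require Import classical_sets ring lra zify.

Set Implicit Arguments.
Unset Strict Implicit.
Unset Printing Implicit Defensive.

Import Order.TTheory GRing.Theory Num.Theory.
Local Open Scope ring_scope.

(** Write c for 1/(p-1), and let pi be a uniformizer of K, with v(pi) = 1/e.

    Lower bound.  Let x be a p-th root of pi.  A conjugate of x is zeta * x with
    zeta^p = 1, and v(zeta - 1) = c if zeta <> 1, so A = v(x) + c is admissible.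
    But v(x) = 1/(ep) is not the value of an element of K, hence v(x - y) <= v(x)
    for all y in K ([ax_bound_attained]).

    Upper bound.  Let Kinf be the union of the fields K_n = K(pi^(1/p^n)).  The
    approximation of x by K is done in two steps.

    From Kbar to Kinf there is no loss: if v(s x - x) >= A for all s fixing Kinf,
    then for all eps > 0 some y in Kinf has v(x - y) >= A - eps ([ax_ext_eps]).
    Some finite loss b is enough for all elements of Kinf(x), because Lagrange
    interpolation at the conjugates of x recovers the constant term of a polynomial
    expression in x ([crude_ax]).  Such a loss can be improved.  Since the value group of
    Kinf is dense, subtracting an approximation and rescaling reduces to an
    integral z that is moved by about b.  Then z^p is moved by min(pb, b + 1), so
    it has an approximation in Kinf up to min((p-1)b, 1).  Frobenius is surjective
    on the integers of Kinf modulo p ([frob_image_Kinf]), so this approximation is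
    a p-th power modulo p, and its p-th root approximates z up to
    min((p-1)b, 1)/p.  The loss has decreased by that amount ([ax_improve]), and
    iterating makes it as small as desired.

    From Kinf to K the loss is at most c: write y in K_n as the sum of the
    y_j pi^(j/p^n) with y_j in K and j < p^n, and let s be the automorphism over K
    that multiplies pi^(1/p^n) by a primitive root of unity zeta of order p^n.
    The terms of s y - y are y_j pi^(j/p^n) (zeta^j - 1), where, for j > 0, the
    value of zeta^j - 1 is 1/(p^(m-1) (p-1)) <= c, p^m being the order of zeta^j.
    The nonzero terms have distinct values ([twisted_values_distinct]), so v(s y - y)
    is the least of them and y - y_0 has value at least v(s y - y) - c ([descent]).

    Finally eps disappears because v(x - y), for y in K, lies in a discrete group
    ([vge_diff_discrete]), and C is reduced to Kbar by density.

    The hypotheses enter as follows.  That W is a Witt ring over a perfect field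
    gives an integral value group on Frac W and the perfectness of its residue
    field, through the formula for p * w in Witt components ([coord_mulp]); K is
    then discretely valued with perfect residue field ([uniformizerP],
    [residue_field_perfect]).  Automorphisms preserve v because they act
    continuously on C ([aut_isometry]), and there are enough of them since Kbar is
    an algebraic closure ([conj_aut]). *)

(** * Valuations *)

Section Valuation.
Variables (R : realType) (L : fieldType) (v : L -> \bar R).

Definition vge (r : R) (x : L) : Prop := (r%:E <= v x)%E.
(** Junk value at 0, where v is infinite; [vge] is used to treat 0 uniformly. *)
Definition fval (x : L) : R := fine (v x).

Hypothesis hv : is_valuation v.

Lemma v_fin x : x != 0 -> v x = (fval x)%:E.
Proof.
move=> x0; rewrite /fval fineK // fin_numE gt_eqF ?(valuation_gtNy hv) //=.
by apply: contra_neq x0 => /(valuation_infty hv).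
Qed.

Lemma vge0 r : vge r 0.
Proof. by rewrite /vge ((valuation_infty hv 0).2 erefl) leey. Qed.

Lemma vge_val r x : x != 0 -> vge r x <-> r <= fval x.
Proof. by move=> x0; rewrite /vge v_fin // lee_fin. Qed.

Lemma vge_valP r x : (x != 0 -> r <= fval x) -> vge r x.
Proof.
have [->|x0] := eqVneq x 0; first by move=> _; exact: vge0.
by move=> /(_ isT) h; apply/vge_val.
Qed.

Lemma vge_le r s x : s <= r -> vge r x -> vge s x.
Proof. by move=> sr; apply: le_trans; rewrite lee_fin. Qed.

Lemma valM x y : x != 0 -> y != 0 -> fval (x * y) = fval x + fval y.
Proof. by move=> x0 y0; rewrite {1}/fval (valuationM hv) !v_fin. Qed.

Lemma val1 : fval 1 = 0.
Proof.
have := @valM 1 1 (oner_neq0 _) (oner_neq0 _); rewrite mulr1 => h; lra.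
Qed.

Lemma valX x n : x != 0 -> fval (x ^+ n) = n%:R * fval x.
Proof.
move=> x0; elim: n => [|n IH]; first by rewrite expr0 val1 mul0r.
by rewrite exprS valM ?expf_neq0 // IH mulrS mulrDl mul1r.
Qed.

Lemma valV x : x != 0 -> fval x^-1 = - fval x.
Proof.
move=> x0; apply/eqP; rewrite -addr_eq0 -valM ?invr_neq0 // mulVf //.
by rewrite val1.
Qed.

Lemma valN x : fval (- x) = fval x.
Proof.
have [->|x0] := eqVneq x 0; first by rewrite oppr0.
have : fval (x * x) = fval (- x * - x) by rewrite mulrNN.
by rewrite !valM ?oppr_eq0 //; lra.
Qed.

Lemma vge1 : vge 0 1.
Proof. by apply/vge_val; rewrite ?oner_neq0 // val1. Qed.

Lemma vgeM r s x y : vge r x -> vge s y -> vge (r + s) (x * y).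
Proof.
move=> rx sy; apply: vge_valP; rewrite mulf_eq0 negb_or => /andP[x0 y0].
by rewrite valM // lerD //; apply/vge_val.
Qed.

Lemma vgeX r n x : vge r x -> vge (n%:R * r) (x ^+ n).
Proof.
move=> rx; elim: n => [|n IH]; first by rewrite mul0r expr0; exact: vge1.
by rewrite exprS mulrS mulrDl mul1r; apply: vgeM.
Qed.

Lemma vgeX0 n x : vge 0 x -> vge 0 (x ^+ n).
Proof. by move/(vgeX n); rewrite mulr0. Qed.

Lemma vgeM0 r x y : vge 0 x -> vge r y -> vge r (x * y).
Proof. by move=> x0 /(vgeM x0); rewrite add0r. Qed.

Lemma vgeM0r r x y : vge r x -> vge 0 y -> vge r (x * y).
Proof. by move=> x0 /(vgeM x0); rewrite addr0. Qed.

Lemma vgeX_root r n x : (0 < n)%N -> vge r (x ^+ n) -> vge (r / n%:R) x.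
Proof.
move=> n0 rx; apply: vge_valP => x0.
move/vge_val: rx; rewrite expf_neq0 // valX // => /(_ isT).
by rewrite ler_pdivrMr ?ltr0n // mulrC.
Qed.

Lemma vgeN r x : vge r (- x) <-> vge r x.
Proof.
have [->|x0] := eqVneq x 0; first by rewrite oppr0.
by rewrite !vge_val ?oppr_eq0 // valN.
Qed.

Lemma vgeD r x y : vge r x -> vge r y -> vge r (x + y).
Proof.
move=> rx ry; apply: le_trans (valuationD hv x y).
by rewrite le_min; apply/andP.
Qed.

Lemma vgeB r x y : vge r x -> vge r y -> vge r (x - y).
Proof. by move=> rx ry; apply: vgeD => //; apply/vgeN. Qed.

Lemma vgeBC r x y : vge r (x - y) -> vge r (y - x).
Proof. by move/vgeN; rewrite opprB. Qed.

Lemma vge_trans r y x z : vge r (x - y) -> vge r (y - z) -> vge r (x - z).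
Proof. by move=> xy /(vgeD xy); rewrite addrA subrK. Qed.

Lemma vge_sum r I (s : seq I) (P : pred I) (F : I -> L) :
  (forall i, P i -> vge r (F i)) -> vge r (\sum_(i <- s | P i) F i).
Proof. by move=> h; apply: big_ind => //; [exact: vge0|exact: vgeD]. Qed.

Lemma vge_nat n : vge 0 n%:R.
Proof.
elim: n => [|n IH]; first exact: vge0.
by rewrite -addn1 natrD; apply: vgeD => //; exact: vge1.
Qed.


Lemma valDl x y r : x != 0 -> vge r y -> fval x < r ->
  x + y != 0 /\ fval (x + y) = fval x.
Proof.
move=> x0 ry xr.
have lt s : vge s (x + y) -> fval x < s -> False.
  move=> h hs; have : vge (Num.min s r) x.
    rewrite -[x](addrK y); apply: vgeB; [apply: vge_le h|apply: vge_le ry].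
      by rewrite ge_min lexx.
    by rewrite ge_min lexx orbT.
  by rewrite vge_val // leNgt lt_min hs xr.
have xy0 : x + y != 0.
  by apply/eqP => e; apply: (lt (fval x + 1)); [rewrite e; exact: vge0|lra].
split=> //; apply/eqP; rewrite eq_le; apply/andP; split.
  rewrite leNgt; apply/negP => h; apply: (lt _ _ h).
  by apply/vge_val.
apply/vge_val => //; apply: vgeD; first by apply/vge_val.
exact: vge_le (ltW xr) ry.
Qed.

Lemma vgeD_neq r x y : x != 0 -> (y != 0 -> fval x != fval y) ->
  vge r (x + y) -> r <= fval x.
Proof.
move=> x0; have [->|y0] := eqVneq y 0; first by rewrite addr0 vge_val.
move=> /(_ isT); rewrite neq_lt => /orP[xy|xy].
  have [xy0 <-] := valDl x0 ((vge_val _ y0).2 (lexx (fval y))) xy.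
  by rewrite vge_val.
have [xy0 e] := valDl y0 ((vge_val _ x0).2 (lexx (fval x))) xy.
by rewrite addrC vge_val // e; lra.
Qed.

(** When nonzero terms have distinct values, the value of the sum is the least of
    the values of the terms. *)
Lemma vge_sum_distinct r (I : finType) (P : pred I) (F : I -> L) :
  (forall a b, P a -> P b -> a != b -> F a != 0 -> F b != 0 ->
     fval (F a) != fval (F b)) ->
  vge r (\sum_(a | P a) F a) -> forall a, P a -> vge r (F a).
Proof.
move=> dis h a Pa.
have [//|nh] := pselect (vge r (F a)).
have Fa0 : [pred c | P c && (F c != 0)] a.
  by rewrite /= Pa /=; apply/eqP => e; apply: nh; rewrite e; exact: vge0.
have [b /andP[Pb Fb0] bmin] := arg_minP (fun a => fval (F a)) Fa0.
have [P1|P1] := pselect (exists c, [pred c | [&& P c, F c != 0 & c != b]] c);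
  last first.
  move: h; rewrite (bigD1 b) //= big1 ?addr0.
    rewrite vge_val // => h; apply/vge_val; first by case/andP: Fa0.
    exact: le_trans h (bmin _ Fa0).
  move=> c /andP[Pc cb]; apply/eqP/negP => /negP c0; apply: P1; exists c.
  by rewrite /= Pc c0 cb.
case: P1 => c0 Pc0.
have [c /and3P[Pc Fc0 cb] cmin] := arg_minP (fun a => fval (F a)) Pc0.
have bc : fval (F b) < fval (F c).
  rewrite lt_neqAle dis ?(eq_sym b) //=.
  by apply: bmin; rewrite /= Pc Fc0.
move: h; rewrite (bigD1 b) //= => h.
have rest : vge (fval (F c)) (\sum_(i | P i && (i != b)) F i).
  apply: vge_sum => i /andP[Pi ib]; apply: vge_valP => Fi0.
  by apply: cmin; rewrite /= Pi Fi0 ib.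
have [s0 e] := valDl Fb0 rest bc.
move: h; rewrite vge_val // e => h.
apply/vge_val; first by case/andP: Fa0.
exact: le_trans h (bmin _ Fa0).
Qed.

Lemma vge_all_eq0 x : (forall r, vge r x) -> x = 0.
Proof.
move=> h; apply/eqP/negP => /negP x0.
by have /vge_val := h (fval x + 1); move=> /(_ x0); lra.
Qed.

Lemma sum_distinct_eq0 (I : finType) (P : pred I) (F : I -> L) :
  (forall a b, P a -> P b -> a != b -> F a != 0 -> F b != 0 ->
     fval (F a) != fval (F b)) ->
  \sum_(a | P a) F a = 0 -> forall a, P a -> F a = 0.
Proof.
move=> dis h a Pa; apply: vge_all_eq0 => r.
by apply: (vge_sum_distinct dis) Pa; rewrite h; exact: vge0.
Qed.

End Valuation.

Section ValExtra.
Variables (R : realType) (L : fieldType) (v : L -> \bar R).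
Hypothesis hv : is_valuation v.
Notation fval := (fval v). Notation vge := (vge v).

Lemma valXz x (q : int) : x != 0 -> fval (x ^ q) = q%:~R * fval x.
Proof.
move=> x0; case: q => n; first by rewrite -exprnP (valX hv).
rewrite -[x ^ _]/((x ^+ n.+1)^-1) (valV hv) ?expf_neq0 // (valX hv) //.
by rewrite NegzE mulrNz mulNr.
Qed.

Lemma is_valuation_comp (L' : fieldType) (f : {rmorphism L' -> L}) :
  is_valuation (fun x => v (f x)).
Proof.
split.
- move=> x; rewrite (valuation_infty hv); split=> [/eqP|->]; last exact: rmorph0.
  by rewrite fmorph_eq0 => /eqP.
- by move=> x; exact: valuation_gtNy hv _.
- by move=> x y; rewrite rmorphM; exact: valuationM hv _ _.
- by move=> x y; rewrite rmorphD; exact: valuationD hv _ _.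
Qed.

(** Two nonzero terms of P(x) = 0 must have the same value, which determines v(x)
    from the values of two coefficients and the difference of their degrees. *)
Lemma root_val (m N : nat) (P : {poly L}) x : (0 < m)%N -> (size P <= N.+1)%N ->
  P != 0 -> root P x -> x != 0 ->
  (forall k, P`_k != 0 -> exists a : int, fval P`_k = a%:~R / m%:R) ->
  exists a : int, fval x = a%:~R / (N`! * m)%:R.
Proof.
move=> m0 sPN P0 Px x0 cP.
pose F (k : 'I_(size P)) := P`_k * x ^+ k.
have sumF : \sum_k F k = 0 by rewrite -horner_coef (rootP Px).
have : ~ forall a b, xpredT a -> xpredT b -> a != b -> F a != 0 -> F b != 0 ->
    fval (F a) != fval (F b).
  move=> dis; have := sum_distinct_eq0 hv dis sumF.
  have sP : ((size P).-1 < size P)%N by rewrite prednK // size_poly_gt0.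
  move=> /(_ (Ordinal sP) isT) /eqP; rewrite /F /= mulf_eq0 -lead_coefE.
  by rewrite lead_coef_eq0 (negPf P0) expf_eq0 (negPf x0) andbF.
move/existsNP=> [a /existsNP[b H]].
have [ab [Fa [Fb e]]] : a != b /\ F a != 0 /\ F b != 0 /\ fval (F a) = fval (F b).
  apply: contrapT => h; apply: H => _ _ ab Fa Fb; apply/eqP => e.
  by apply: h.
have {H} main (a' b' : 'I_(size P)) : F a' != 0 -> F b' != 0 ->
    fval (F a') = fval (F b') -> (a' < b')%N ->
    exists a : int, fval x = a%:~R / (N`! * m)%:R.
  rewrite /F !mulf_eq0 !negb_or => /andP[Pa xa] /andP[Pb xb].
  rewrite !(valM hv) // !(valX hv) // => E lt.
  have [[u hu] [w hw]] := (cP _ Pa, cP _ Pb).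
  set l := (b' - a')%N; have l0 : (0 < l)%N by rewrite subn_gt0.
  have lx : l%:R * fval x = (u - w)%:~R / m%:R.
    by rewrite natrB ?(ltnW lt) // rmorphB mulrBl mulrBl /= -hu -hw; lra.
  have lN : (l <= N)%N.
    rewrite -ltnS; apply: leq_trans sPN; apply: leq_ltn_trans (leq_subr _ _) _.
    exact: ltn_ord.
  have /dvdnP[q eq] : (l %| N`!)%N by rewrite dvdn_fact // l0.
  have q0 : (0 < q)%N by move: (fact_gt0 N); rewrite eq muln_gt0 => /andP[].
  exists ((u - w) * q); rewrite eq !natrM rmorphM /= -[q%:~R]pmulrn.
  have nz n : (0 < n)%N -> (n%:R : R) != 0 by rewrite pnatr_eq0 -lt0n.
  apply: (mulfI (nz _ l0)); rewrite lx; field.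
  by rewrite !nz.
have [lt|lt|/val_inj eq] := ltngtP a b.
- exact: main lt.
- exact: main lt.
- by rewrite eq eqxx in ab.
Qed.

(** A bounded denominator makes the value group discrete; it contains v(p) = 1, so
    the smallest positive value is the inverse of an integer. *)
Lemma uniformizerP (p m : nat) : (0 < m)%N -> v p%:R = 1%:E ->
  (forall x : L, x != 0 -> exists a : int, fval x = a%:~R / m%:R) ->
  exists e : nat, exists pi : L, [/\ (0 < e)%N, pi != 0, fval pi = e%:R^-1 &
    forall x : L, x != 0 -> exists a : int, fval x = a%:~R / e%:R].
Proof.
move=> m0 vp hm.
have mR : (m%:R : R) != 0 by rewrite pnatr_eq0 -lt0n.
have mR0 : 0 < (m%:R : R) by rewrite ltr0n.
have p0 : (p%:R : L) != 0.
  by apply/eqP => e; move: vp; rewrite e ((valuation_infty hv 0).2 erefl).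
have valp : fval p%:R = 1 by rewrite /fval vp.
pose Q n := (0 < n)%N && `[<exists x : L, x != 0 /\ fval x = n%:R / m%:R>].
have exQ : exists n, Q n.
  by exists m; rewrite /Q m0 /=; apply/asboolP; exists p%:R; rewrite valp divff.
case: (ex_minnP exQ) => n /andP[n0 /asboolP[pi [pi0 vpi]]] minn.
have nR0 : 0 < (n%:R : R) by rewrite ltr0n.
have key (x : L) : x != 0 -> exists a : int, fval x = a%:~R * (n%:R / m%:R).
  move=> x0; have [a ha] := hm _ x0.
  exists (a %/ n)%Z.
  have nz : (n : int) != 0 by lia.
  have rE := divz_eq a n; have r0 := modz_ge0 a nz; have rn := ltz_mod a nz.
  set q := (a %/ n)%Z in rE *; set r := (a %% n)%Z in rE r0 rn *.
  have vr : fval (x / pi ^ q) = `|r|%:R / m%:R.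
    rewrite (valM hv) ?invr_neq0 ?expfz_neq0 // (valV hv) ?expfz_neq0 //.
    rewrite (valXz) // vpi ha rE -[`|r|%:R]/((Posz `|r|)%:~R) gez0_abs //.
    by rewrite rmorphD rmorphM /= mulrDl; lra.
  have [r00|rpos] := posnP `|r|.
    move: vr; rewrite r00 mul0r (valM hv) ?invr_neq0 ?expfz_neq0 //.
    by rewrite (valV hv) ?expfz_neq0 // valXz // vpi; lra.
  have : Q `|r|%N.
    rewrite /Q rpos /=; apply/asboolP; exists (x / pi ^ q); split=> //.
    by rewrite mulf_neq0 ?invr_neq0 ?expfz_neq0.
  move/minn; lia.
have [a ha] := key _ p0.
rewrite valp in ha.
have a0 : 0 < a.
  rewrite -(ltr0z R); have : 0 < a%:~R * (n%:R / m%:R) :> R by rewrite -ha.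
  by rewrite pmulr_lgt0 // divr_gt0.
have aE : (`|a|%:R : R) = a%:~R by rewrite -[`|a|%:R]/((Posz `|a|)%:~R) gez0_abs ?ltW.
have nm : n%:R / m%:R = `|a|%:R^-1 :> R.
  have an0 : (a%:~R : R) != 0 by rewrite intr_eq0; lia.
  by rewrite aE; apply: (mulfI an0); rewrite -ha mulfV.
exists `|a|%N, pi; split=> //; first by lia.
  by rewrite vpi.
by move=> x x0; have [b ->] := key _ x0; exists b; rewrite nm.
Qed.

End ValExtra.

(** * Extension of isomorphisms to an algebraic closure *)

Section Subfield.
Variables (L : fieldType) (S : L -> Prop).
Hypotheses (S1 : S 1) (SB : forall x y, S x -> S y -> S (x - y))
  (SV : forall x y, S x -> S y -> S (x / y)).

Definition subfield_of_pred : {pred L} := fun x => `[<S x>].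

Fact subfield_of_divring_closed : divring_closed subfield_of_pred.
Proof.
split; first exact/asboolP.
  by move=> x y /asboolP Sx /asboolP Sy; apply/asboolP/SB.
by move=> x y /asboolP Sx /asboolP Sy; apply/asboolP/SV.
Qed.

HB.instance Definition _ :=
  GRing.isDivringClosed.Build L subfield_of_pred subfield_of_divring_closed.

Record subfield_of :=
  SubfieldOf { subfield_of_val :> L; _ : subfield_of_val \in subfield_of_pred }.

HB.instance Definition _ := [isSub for subfield_of_val].
HB.instance Definition _ := [Choice of subfield_of by <:].
HB.instance Definition _ := [SubChoice_isSubIntegralDomain of subfield_of by <:].
HB.instance Definition _ := [SubIntegralDomain_isSubField of subfield_of by <:].

(** Subfields are handled as field types with an embedding, which gives access to
    polynomials and their divisibility over them. *)
Lemma subfield_type : exists (E : fieldType) (f : {rmorphism E -> L}),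
  forall x, S x <-> exists a, x = f a.
Proof.
exists subfield_of, (\val : {rmorphism subfield_of -> L}) => x; split.
  by move=> /asboolP Sx; exists (SubfieldOf Sx).
by move=> [[y Sy] ->]; apply/asboolP.
Qed.

End Subfield.

Section MinPoly.
Variables (E L : fieldType) (f : {rmorphism E -> L}).

Lemma min_polyP z : algebraicOver f z -> exists2 M : {poly E},
  M != 0 & forall P, root (map_poly f P) z <-> M %| P.
Proof.
move=> [p p0 pz].
pose Q n := `[<exists P : {poly E}, [/\ P != 0, root (map_poly f P) z & size P = n]>].
have exQ : exists n, Q n by exists (size p); apply/asboolP; exists p.
case: (ex_minnP exQ) => n /asboolP[M [M0 Mz sM]] minM.
exists M => // P; split; last first.
  by move=> /dvdpP[q ->]; rewrite rmorphM rootM Mz orbT.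
move=> Pz; apply: contraT => /negP nd.
have R0 : modp P M != 0 by apply/eqP => e; apply: nd; rewrite /dvdp e.
suff : (n <= size (modp P M))%N by rewrite leqNgt -sM ltn_modp M0.
apply: minM; apply/asboolP; exists (modp P M); split=> //.
move: Pz; rewrite {1}(divp_eq P M) rmorphD rmorphM /= rootE hornerD hornerM.
by rewrite (rootP Mz) mulr0 add0r.
Qed.

Lemma min_poly_coprime z (M P : {poly E}) :
  M != 0 -> (forall P, root (map_poly f P) z <-> M %| P) ->
  ~ root (map_poly f P) z -> coprimep P M.
Proof.
move=> M0 hM nPz.
have /dvdpP[h eh] := dvdp_gcdr P M.
have : root (map_poly f M) z by apply/hM; exact: dvdpp.
rewrite {1}eh rmorphM rootM => /orP[hz|gz]; last first.
  case: nPz; apply/hM; apply: dvdp_trans (dvdp_gcdl P M).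
  exact/hM.
have /dvdpP[q eq] : M %| h by apply/hM.
have e1 : q * gcdp P M = 1.
  by apply: (mulfI M0); rewrite mulr1 mulrA [M * q]mulrC -eq -eh.
rewrite /coprimep -dvdp1 -e1; exact: dvdp_mull.
Qed.

Lemma min_poly_conj (L' : fieldType) (g : {rmorphism E -> L'}) z z' (M : {poly E}) :
  M != 0 -> (forall P, root (map_poly f P) z <-> M %| P) -> root (map_poly g M) z' ->
  forall P, root (map_poly f P) z <-> root (map_poly g P) z'.
Proof.
move=> M0 hM Mz' P; split.
  by move=> /hM/dvdpP[q ->]; rewrite rmorphM rootM Mz' orbT.
move=> Pz'; apply: contrapT => nPz.
have cop := min_poly_coprime M0 hM nPz.
have /Bezout_eq1_coprimepP[[u w] /= e] := cop.
have := congr1 (fun q => (map_poly g q).[z']) e.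
rewrite /= rmorphD !rmorphM /= hornerD !hornerM (rootP Pz') (rootP Mz') !mulr0.
by rewrite add0r rmorph1 hornerC => /eqP; rewrite eq_sym oner_eq0.
Qed.
End MinPoly.

Section Extension.
Local Open Scope classical_set_scope.
Variables (E L : fieldType) (f : {rmorphism E -> L}).

(** Graphs of isomorphisms over E between two subfields of L: the last clause makes
    both projections injective on G. *)
Definition partial_iso (G : set (L * L)) : Prop :=
  [/\ forall a, G (f a, f a),
      forall a b a' b', G (a, b) -> G (a', b') -> G (a - a', b - b'),
      forall a b a' b', G (a, b) -> G (a', b') -> G (a / a', b / b') &
      forall a b, G (a, b) -> a = 0 <-> b = 0].

(** The extension of u(d) |-> g(d) that sends z to z'. *)
Definition fraction_graph (D : fieldType) (u g : D -> L) (z z' : L) : set (L * L) :=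
  [set x | exists P Q : {poly D},
    [/\ (map_poly u Q).[z] != 0, x.1 = (map_poly u P).[z] / (map_poly u Q).[z]
      & x.2 = (map_poly g P).[z'] / (map_poly g Q).[z'] ] ].

Lemma partial_iso_fraction_graph (D : fieldType) (u g : {rmorphism D -> L}) z z' :
  (forall a, exists2 d, u d = f a & g d = f a) ->
  (forall P : {poly D}, root (map_poly u P) z <-> root (map_poly g P) z') ->
  partial_iso (fraction_graph u g z z').
Proof.
move=> ugf zz'.
have nz P : (map_poly u P).[z] != 0 -> (map_poly g P).[z'] != 0.
  by move=> /negP h; apply/negP => h'; apply: h; apply/zz'.
split.
- move=> a; have [d ud gd] := ugf a; exists d%:P, 1.
  by rewrite !rmorph1 !hornerC oner_eq0 !divr1 !map_polyC /= !hornerC ud gd.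
- move=> a b a' b' [P [Q /= [Q0 -> ->]]] [P' [Q' /= [Q'0 -> ->]]].
  exists (P * Q' - P' * Q), (Q * Q').
  rewrite !rmorphB !rmorphM /= !hornerD !hornerN !hornerM.
  have := nz _ Q0; have := nz _ Q'0 => gQ' gQ.
  split; first by rewrite mulf_neq0.
    by field; apply/andP.
  by field; apply/andP.
- move=> a b a' b' [P [Q /= [Q0 -> ->]]] [P' [Q' /= [Q'0 -> ->]]].
  have gQ' := nz _ Q'0; have gQ := nz _ Q0.
  have [e|P'0] := eqVneq (map_poly u P').[z] 0.
    have e' : (map_poly g P').[z'] = 0 by apply/rootP/zz'/rootP.
    exists 0, 1; rewrite !rmorph0 !rmorph1 !hornerC e e' oner_eq0.
    by rewrite !mul0r !invr0 !mulr0.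
  exists (P * Q'), (Q * P'); have gP' := nz _ P'0.
  rewrite !rmorphM /= !hornerM mulf_neq0 //.
  by split=> //; field; rewrite ?gP' ?gQ ?gQ' ?P'0 ?Q0 ?Q'0.
- move=> a b [P [Q /= [Q0 -> ->]]]; have gQ := nz _ Q0.
  split=> /eqP; rewrite mulf_eq0 invr_eq0 ?(negPf Q0) ?(negPf gQ) orbF => /eqP e.
    by have /rootP -> := (zz' P).1 (introT rootP e); rewrite mul0r.
  by have /rootP -> := (zz' P).2 (introT rootP e); rewrite mul0r.
Qed.


Lemma partial_iso_1 G : partial_iso G -> G (1, 1).
Proof. by move=> [h _ _ _]; have := h 1; rewrite !rmorph1. Qed.

Lemma partial_iso_fun G a b b' : partial_iso G -> G (a, b) -> G (a, b') -> b = b'.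
Proof.
move=> [_ hB _ h0] h h'; apply/eqP; rewrite -subr_eq0; apply/eqP.
by apply/(h0 (a - a)); [exact: hB|rewrite subrr].
Qed.

Lemma partial_iso_field G : partial_iso G ->
  exists (D : fieldType) (u g : {rmorphism D -> L}),
  forall a b, G (a, b) <-> exists d, a = u d /\ b = g d.
Proof.
move=> goodG; have [hf hB hV h0] := goodG.
have hN a b : G (a, b) -> G (- a, - b).
  by move=> /(hB _ _ _ _ (hf 0)); rewrite rmorph0 !sub0r.
have hD a b a' b' : G (a, b) -> G (a', b') -> G (a + a', b + b').
  by move=> h /hN h'; have := hB _ _ _ _ h h'; rewrite !opprK.
have hM a b a' b' : G (a, b) -> G (a', b') -> G (a * a', b * b').
  move=> h h'; have := hV _ _ _ _ (partial_iso_1 goodG) h'; rewrite !div1r => hi.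
  by have := hV _ _ _ _ h hi; rewrite !invrK.
have [||| D [u hu]] := @subfield_type L (fun a => exists b, G (a, b)).
- by exists 1; exact: partial_iso_1.
- by move=> x y [b hb] [c hc]; exists (b - c); exact: hB.
- by move=> x y [b hb] [c hc]; exists (b / c); exact: hV.
have ex d : {b | G (u d, b)} by apply/cid/hu; exists d.
pose g d := sval (ex d).
have gP d : G (u d, g d) by rewrite /g; case: (ex d).
have gB : zmod_morphism g.
  move=> x y; apply: partial_iso_fun goodG (gP _) _.
  by rewrite rmorphB; exact: hB.
have gM : monoid_morphism g.
  split; first by apply: partial_iso_fun goodG (gP _) _; rewrite rmorph1; exact: partial_iso_1.
  by move=> x y; apply: partial_iso_fun goodG (gP _) _; rewrite rmorphM; exact: hM.
pose gA := GRing.isZmodMorphism.Build D L g gB.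
pose gMM := GRing.isMonoidMorphism.Build D L g gM.
pose gR : {rmorphism D -> L} := HB.pack g gA gMM.
exists D, u, gR => a b; split.
  move=> Gab; have [d ud] : exists d, a = u d by apply/hu; exists b.
  exists d; split=> //; apply: partial_iso_fun goodG Gab _; rewrite ud; exact: gP.
by move=> [d [-> ->]]; exact: gP.
Qed.

Lemma partial_iso_chain (G0 : set (L * L)) (F : set (set (L * L))) :
  partial_iso G0 ->
  (forall A, F A -> partial_iso (A `|` G0)) -> total_on F subset ->
  partial_iso (\bigcup_(X in F) X `|` G0).
Proof.
move=> g0 gF tot; set U := _ `|` _.
have one x : U x -> exists2 A, partial_iso (A `|` G0) /\ A `|` G0 `<=` U & (A `|` G0) x.
  move=> [[A FA Ax]|G0x].
    exists A; [split; [exact: gF|]|by left].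
    by move=> y [Ay|]; [left; exists A|right].
  exists G0; [rewrite setUid; split=> // y|by left].
  by right.
have two x y : U x -> U y ->
    exists2 A, partial_iso (A `|` G0) /\ A `|` G0 `<=` U & (A `|` G0) x /\ (A `|` G0) y.
  have sub A : F A -> A `|` G0 `<=` U.
    by move=> FA t [At|]; [left; exists A|right].
  move=> Ux Uy; case: (Ux) => [[A FA Ax]|G0x].
    case: (Uy) => [[B FB By]|G0y].
      have [AB|BA] := tot _ _ FA FB.
        by exists B; [split; [exact: gF|exact: sub]|split; left=> //; exact: AB].
      by exists A; [split; [exact: gF|exact: sub]|split; left=> //; exact: BA].
    by exists A; [split; [exact: gF|exact: sub]|split; [left|right]].
  have [A gA Ay] := one _ Uy.
  by exists A => //; split=> //; right.
split.
- by move=> a; right; case: g0.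
- move=> a b a' b' h h'; have [A [[_ hB _ _] sA] [hA hA']] := two _ _ h h'.
  by apply: sA; exact: hB.
- move=> a b a' b' h h'; have [A [[_ _ hV _] sA] [hA hA']] := two _ _ h h'.
  by apply: sA; exact: hV.
- by move=> a b h; have [A [[_ _ _ h0] sA] hA] := one _ h; exact: h0.
Qed.

End Extension.

(** z is sent to a root of the image of its minimal polynomial. *)
Lemma partial_iso_extend (E : fieldType) (L : closedFieldType) (f : {rmorphism E -> L}) G z :
  partial_iso f G -> algebraicOver f z ->
  exists G', [/\ partial_iso f G', G `<=` G' & exists z', G' (z, z')]%classic.
Proof.
move=> goodG algz.
have [D [u [g hG]]] := partial_iso_field goodG.
have algu : algebraicOver u z.
  have [p p0 pz] := algz.
  have hd a : {d | f a = u d /\ f a = g d}.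
    by apply/cid/hG; case: goodG.
  pose q := \poly_(k < size p) sval (hd p`_k).
  have e : map_poly u q = map_poly f p.
    apply/polyP => k; rewrite !coef_map coef_poly.
    have [kp|kp] := ltnP k (size p); first by case: (hd _) => d [].
    by rewrite nth_default //; exact: (etrans (rmorph0 u) (esym (rmorph0 f))).
  exists q; last by rewrite e.
  apply: contra_neq p0 => q0; apply/eqP.
  by rewrite -(map_poly_eq0 f) -e q0 rmorph0.
have [M M0 hM] := min_polyP algu.
have sM : size (map_poly g M) != 1.
  rewrite size_map_poly; apply/negP => /eqP s1.
  have : root (map_poly u M) z by apply/hM; exact: dvdpp.
  have /size_poly1P[c c0 ->] : size M == 1 by apply/eqP.
  by rewrite map_polyC rootC fmorph_eq0 (negPf c0).
have /closed_rootP[z' Mz'] := sM.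
have zz' := min_poly_conj M0 hM Mz'.
exists (fraction_graph u g z z'); split.
- apply: partial_iso_fraction_graph => // a; have /hG[d [e1 e2]] : G (f a, f a) by case: goodG.
  by exists d.
- move=> [a b] /hG[d [-> ->]]; exists d%:P, 1 => /=.
  by rewrite !rmorph1 !hornerC oner_eq0 !divr1 !map_polyC /= !hornerC.
- exists z', 'X, 1 => /=.
  by rewrite !rmorph1 !hornerC oner_eq0 !divr1 !map_polyX /= !hornerX.
Qed.

(** By Zorn's lemma there is a maximal extension of G, which is defined everywhere
    since it could be extended otherwise. *)
Lemma partial_iso_aut (E : fieldType) (L : closedFieldType) (f : {rmorphism E -> L}) G :
  (forall z, algebraicOver f z) -> partial_iso f G ->
  exists2 s : {rmorphism L -> L}, bijective s & forall a b, G (a, b) -> s a = b.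
Proof.
move=> alg goodG.
have [|A [gA maxA]] := @Zorn_bigcup _ (fun A => partial_iso f (A `|` G))%classic.
  by move=> F FP tot; exact: partial_iso_chain.
set U := (A `|` G)%classic in gA.
have dom z : exists z', U (z, z').
  have [G' [gG' sub [z' hz']]] := partial_iso_extend gA (alg z).
  exists z'; apply: contrapT => nU.
  apply: (maxA G').
    split; first by move=> x Ax; apply: sub; left.
    by move=> /(_ _ hz') Az; apply: nU; left.
  by rewrite setUidl // => x Gx; apply: sub; right.
have [D [u [g hG]]] := partial_iso_field gA.
have surj z : {d | z = u d}.
  by apply/cid; have [z' /hG[d [e _]]] := dom z; exists d.
pose s z := g (sval (surj z)).
have sP d : s (u d) = g d.
  rewrite /s; case: (surj _) => d' /= e; congr (g _).
  exact/esym/(fmorph_inj u).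
have sB : zmod_morphism s.
  move=> x y; have [[dx ->] [dy ->]] := (surj x, surj y).
  by rewrite -rmorphB !sP rmorphB.
have sM : monoid_morphism s.
  split.
    by have u1 : u 1 = 1 := rmorph1 u; have := sP 1; rewrite u1 => ->; exact: rmorph1.
  move=> x y; have [[dx ->] [dy ->]] := (surj x, surj y).
  by rewrite -rmorphM !sP rmorphM.
pose sA := GRing.isZmodMorphism.Build L L s sB.
pose sMM := GRing.isMonoidMorphism.Build L L s sM.
pose sR : {rmorphism L -> L} := HB.pack s sA sMM.
have sG a b : U (a, b) -> sR a = b by move=> /hG[d [-> ->]]; exact: sP.
exists sR; last by move=> a b Gab; apply: sG; right.
have sf a : sR (f a) = f a by apply: sG; right; case: goodG.
have inj : injective sR by exact: fmorph_inj.
have onto y : {x | y = sR x}.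
  apply/cid; have [p p0 py] := alg y.
  have [r er] := closed_field_poly_normal (map_poly f p).
  have p0' : lead_coef (map_poly f p) != 0 by rewrite lead_coef_eq0 map_poly_eq0.
  have memr x : (x \in undup r) = root (map_poly f p) x.
    by rewrite mem_undup er rootZ // root_prod_XsubC.
  have ur : uniq (map sR (undup r)) by rewrite map_inj_uniq // undup_uniq.
  have [||_ e] := uniq_min_size ur (s2 := undup r).
  - move=> _ /mapP[x xr ->]; rewrite memr; rewrite memr in xr.
    have {1}-> : map_poly f p = map_poly sR (map_poly f p).
      by rewrite -map_poly_comp; apply: eq_map_poly => a; exact/esym/sf.
    by rewrite fmorph_root.
  - by rewrite size_map.
  have : y \in map sR (undup r) by rewrite e memr.
  by move=> /mapP[x _ ->]; exists x.
(* an injective map that permutes the roots of each polynomial over E is onto *)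
exists (fun y => sval (onto y)) => x.
  by apply: inj; case: (onto _) => y /=.
by case: (onto _) => y /=.
Qed.

(** The hypothesis on x' says that it is a root of the minimal polynomial of x
    over E. *)
Lemma conj_aut (K E : fieldType) (L : closedFieldType) (i : {rmorphism K -> L})
  (f : {rmorphism E -> L}) x x' :
  (forall a, exists d, f d = i a) -> (forall z, algebraicOver f z) ->
  (forall P : {poly E}, root (map_poly f P) x -> root (map_poly f P) x') ->
  exists s : field_aut i, (forall a, s (f a) = f a) /\ s x = x'.
Proof.
move=> fi alg h.
have [M M0 hM] := min_polyP (alg x).
have Mx' : root (map_poly f M) x' by apply: h; apply/hM; exact: dvdpp.
have gd : partial_iso f (fraction_graph f f x x').
  apply: partial_iso_fraction_graph; first by move=> a; exists a.
  exact: min_poly_conj M0 hM Mx'.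
have [s bs sP] := partial_iso_aut alg gd.
have sf a : s (f a) = f a by apply: sP; case: gd.
have sx : s x = x'.
  apply: sP; exists 'X, 1 => /=.
  by rewrite !rmorph1 !hornerC oner_eq0 !divr1 !map_polyX /= !hornerX.
have si a : s (i a) = i a by have [d <-] := fi a.
by exists (FieldAut bs si).
Qed.

(** * Multiplication by p on Witt vectors *)

Section Congruence.
Variables (p : nat) (A : comNzRingType).

Definition pdvd (m : nat) (x : A) : Prop := exists c, x = (p ^ m)%:R * c.

Lemma pdvd0 m : pdvd m 0. Proof. by exists 0; rewrite mulr0. Qed.

Lemma pdvdD m x y : pdvd m x -> pdvd m y -> pdvd m (x + y).
Proof. by move=> [c ->] [d ->]; exists (c + d); rewrite mulrDr. Qed.

Lemma pdvdN m x : pdvd m x -> pdvd m (- x).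
Proof. by move=> [c ->]; exists (- c); rewrite mulrN. Qed.

Lemma pdvdM m n x y : pdvd m x -> pdvd n y -> pdvd (m + n) (x * y).
Proof.
by move=> [c ->] [d ->]; exists (c * d); rewrite expnD natrM; ring.
Qed.

Lemma pdvdMr m x y : pdvd m x -> pdvd m (x * y).
Proof. by move=> [c ->]; exists (c * y); rewrite mulrA. Qed.

Lemma pdvd_le m n x : (n <= m)%N -> pdvd m x -> pdvd n x.
Proof.
move=> nm [c ->]; exists ((p ^ (m - n))%:R * c).
by rewrite mulrA -natrM -expnD subnKC.
Qed.

Lemma pdvd_sum m I (r : seq I) (P : pred I) (F : I -> A) :
  (forall i, P i -> pdvd m (F i)) -> pdvd m (\sum_(i <- r | P i) F i).
Proof. by move=> h; apply: big_ind => //; [exact: pdvd0|exact: pdvdD]. Qed.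

Lemma pdvd_subX m n x y : pdvd m (x - y) -> pdvd m (x ^+ n - y ^+ n).
Proof. by rewrite subrXX; exact: pdvdMr. Qed.

Lemma pdvd_subXp m x y : (0 < m)%N -> pdvd m (x - y) ->
  pdvd m.+1 (x ^+ p - y ^+ p).
Proof.
move=> m0 xy; rewrite subrXX -addn1; apply: pdvdM => //.
have xy1 := pdvd_le m0 xy.
have -> : \sum_(i < p) x ^+ (p.-1 - i) * y ^+ i =
    \sum_(i < p) (x ^+ (p.-1 - i) - y ^+ (p.-1 - i)) * y ^+ i + p%:R * y ^+ p.-1.
  under [X in _ = X + _]eq_bigr => i _ do rewrite mulrBl -exprD.
  rewrite sumrB.
  have -> : \sum_(i < p) y ^+ (p.-1 - i + i) = p%:R * y ^+ p.-1.
    rewrite (eq_bigr (fun=> y ^+ p.-1)) ?sumr_const ?card_ord ?mulr_natl //.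
    move=> i _; rewrite subnK // -ltnS; exact: leq_trans (ltn_ord i) (leqSpred _).
  by rewrite subrK.
apply: pdvdD; last by exists (y ^+ p.-1); rewrite expn1.
by apply: pdvd_sum => i _; apply: pdvdMr; exact: pdvd_subX.
Qed.

Lemma pdvd_subXpn m x y : pdvd 1 (x - y) ->
  pdvd m.+1 (x ^+ (p ^ m) - y ^+ (p ^ m)).
Proof.
move=> xy; elim: m => [|m IH]; first by rewrite expn0 !expr1.
by rewrite expnSr !exprM; exact: pdvd_subXp.
Qed.

End Congruence.

(** The n-th ghost component determines p^n s_n from the previous components, and
    s_i = t_i mod p implies s_i^(p^m) = t_i^(p^m) mod p^(m+1). *)
Lemma ghost_congr (p : nat) (A : idomainType) (s t : nat -> A) :
  prime p -> (p%:R : A) != 0 ->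
  (forall n, pdvd p n.+1 (ghost p s n - ghost p t n)) ->
  forall n, pdvd p 1 (s n - t n).
Proof.
move=> pp p0 h n; have [m] := ubnP n; elim: m n => // m IH n nm.
have pn0 : ((p ^ n)%:R : A) != 0 by rewrite natrX expf_neq0.
have := h n; rewrite /ghost !big_ord_recr /= subnn expn0 !expr1.
rewrite opprD addrACA -mulrBr -sumrB => hn.
have : pdvd p n.+1 ((p ^ n)%:R * (s n - t n)).
  rewrite -[X in pdvd _ _ X](addKr (\sum_(i < n)
    ((p ^ i)%:R * s i ^+ (p ^ (n - i)) - (p ^ i)%:R * t i ^+ (p ^ (n - i))))).
  apply: pdvdD => //; apply/pdvdN/pdvd_sum => i _; rewrite -mulrBr.
  have -> : n.+1 = (i + (n - i).+1)%N by rewrite addnS subnKC // ltnW.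
  apply: pdvdM; first by exists 1; rewrite mulr1.
  by apply: pdvd_subXpn; apply: IH; exact: leq_trans (ltn_ord i) _.
move=> [c]; rewrite expnSr natrM -mulrA => /(mulfI pn0) ->.
by exists c; rewrite expn1.
Qed.

Lemma eval_law_morph (A B : comNzRingType) (g : {rmorphism A -> B}) n
    (S : mpoly.mpoly (n.+1 + n.+1) int) (a b : nat -> A) :
  g (eval_law S a b) = eval_law S (g \o a) (g \o b).
Proof.
rewrite /eval_law /mpoly.mmap rmorph_sum; apply: eq_bigr => m _.
rewrite rmorphM rmorph_int /mpoly.mmap1 rmorph_prod; congr (_ * _).
by apply: eq_bigr => i _; rewrite rmorphXn; case: (split i).
Qed.

Section WittRing.
Variables (p : nat) (k : fieldType) (W : idomainType) (coord : W -> nat -> k).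
Hypotheses (pp : prime p) (hk : perfect_field p k) (hW : is_witt_ring p coord).
Hypothesis p0 : (p%:R : W) != 0.

Lemma ghost0 (A : comNzRingType) (u : nat -> A) : ghost p u 0 = u 0.
Proof. by rewrite /ghost big_ord1 expn0 expr1 mul1r. Qed.

Lemma coord0D w w' : coord (w + w') 0 = coord w 0 + coord w' 0.
Proof.
have [S hS hD] := wittD hW.
by rewrite hD; have := hS k (coord w) (coord w') 0; rewrite !ghost0.
Qed.

Lemma coord0M w w' : coord (w * w') 0 = coord w 0 * coord w' 0.
Proof.
have [S hS hM] := wittM hW.
by rewrite hM; have := hS k (coord w) (coord w') 0; rewrite !ghost0.
Qed.

Lemma coord0_surj (x : k) : {w | coord w 0 = x}.
Proof. by apply/cid; have [w hw] := witt_surj hW (fun=> x); exists w. Qed.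

Lemma coord01 : coord 1 0 = 1.
Proof.
have [e he] := coord0_surj 1.
by have := coord0M 1 e; rewrite mul1r he mulr1 => <-.
Qed.

Fact coord0_zmod : zmod_morphism (coord^~ 0).
Proof.
move=> x y /=; apply/eqP; rewrite eq_sym subr_eq -coord0D subrK; exact/eqP.
Qed.
Fact coord0_monoid : monoid_morphism (coord^~ 0).
Proof. split; [exact: coord01|exact: coord0M]. Qed.

Definition residue : W -> k := coord^~ 0.
HB.instance Definition _ := GRing.isZmodMorphism.Build W k residue coord0_zmod.
HB.instance Definition _ := GRing.isMonoidMorphism.Build W k residue coord0_monoid.

Lemma residue_p : residue p%:R = 0.
Proof.
rewrite rmorph_nat; apply/eqP; have [+ _] := hk.
by rewrite inE => /andP[_].
Qed.

(** This is p = V F.  The component map residue : W -> k is a surjective morphism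
    and W has no p-torsion, so W itself serves as a lift of k in which the Witt
    laws can be compared through ghost components: the vector of a_n and the
    vector (0, a_0^p, a_1^p, ...) satisfy
    p * ghost_n(a) - ghost_n(0, a_0^p, ...) = p^(n+1) a_n. *)
Lemma coord_mulp w n : coord (w *+ p) n = if n is m.+1 then coord w m ^+ p else 0.
Proof.
have [S hS hD] := wittD hW.
pose it (A : comNzRingType) (a : nat -> A) m : nat -> A :=
  iter m (fun u n => eval_law (S n) u a) a.
have it_coord m : coord (w *+ m.+1) = it k (coord w) m.
  elim: m => [|m IH]; first by rewrite mulr1n.
  by rewrite mulrSr; apply/funext => l; rewrite hD IH.
have it_ghost (A : comNzRingType) (a : nat -> A) m l :
    ghost p (it A a m) l = ghost p a l *+ m.+1.
  elim: m => [//|m IH]; rewrite mulrSr -IH -hS /it /=.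
  by congr (ghost p _ l); apply/funext.
have it_morph (A B : comNzRingType) (g : {rmorphism A -> B}) (a : nat -> A) m :
    g \o it A a m = it B (g \o a) m.
  by elim: m => [//|m IH]; apply/funext => l /=; rewrite eval_law_morph IH.
pose a l := sval (coord0_surj (coord w l)).
have ra : residue \o a = coord w.
  by apply/funext => l /=; rewrite /a; case: coord0_surj.
pose t l := if l is m.+1 then a m ^+ p else 0.
have pE : p = p.-1.+1 by rewrite prednK // prime_gt0.
have cong : forall l, pdvd p 1 (it W a p.-1 l - t l).
  apply: ghost_congr => // l; rewrite it_ghost -pE.
  exists (a l); rewrite /ghost big_ord_recr /= subnn expr1.
  rewrite [X in _ - X]big_ord_recl /= subn0 expr0n expn_eq0.
  rewrite (gtn_eqF (prime_gt0 pp)) /= mulr0 add0r.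
  rewrite mulrnDl addrAC -sumrMnl -sumrB big1 ?add0r.
    by rewrite -[LHS]mulr_natl expnS natrM mulrA.
  move=> i _; rewrite /bump /= add1n expnS natrM -exprM -expnS.
  by rewrite -[X in X - _]mulr_natl mulrA add0n subnSK // subrr.
have [c /eqP] := cong n; rewrite subr_eq => /eqP.
move/(congr1 residue); rewrite rmorphD rmorphM /= expn1 residue_p mul0r add0r.
have -> : residue (it W a p.-1 n) = coord (w *+ p) n.
  by rewrite {2}pE it_coord -ra -it_morph.
move=> ->; case: n => [|n] /=; first by rewrite rmorph0.
by rewrite rmorphXn -ra.
Qed.

(** The p-th roots of the components of w, shifted by one, are the components of a
    quotient of w by p. *)
Lemma residue_ker w : residue w = 0 -> exists w', w = p%:R * w'.
Proof.
move=> w0; have [_ perf] := hk.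
have ex l : {y | y ^+ p = coord w l.+1} by exact/cid/perf.
have [w' hw'] := witt_surj hW (fun l => sval (ex l)).
exists w'; rewrite mulr_natl; apply: (witt_inj hW) => -[|n].
  by rewrite coord_mulp.
by rewrite coord_mulp hw'; case: (ex n).
Qed.

Lemma residue_frob w : exists w' c : W, w = w' ^+ p + p%:R * c.
Proof.
have [_ perf] := hk; have [y hy] := perf (residue w).
have [w' hw'] := coord0_surj y.
have [c hc] : exists c, w - w' ^+ p = p%:R * c.
  apply: residue_ker; rewrite rmorphB rmorphXn /= -hy.
  by rewrite [residue w']hw' subrr.
by exists w', c; rewrite -hc addrC subrK.
Qed.

Lemma residue_inv w : residue w != 0 -> exists w' c : W, w * w' = 1 + p%:R * c.
Proof.
move=> w0; have [w' hw'] := coord0_surj (residue w)^-1.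
have [c hc] : exists c, w * w' - 1 = p%:R * c.
  apply: residue_ker; rewrite rmorphB rmorphM rmorph1 /= [residue w']hw'.
  by rewrite mulfV // subrr.
by exists w', c; rewrite -hc addrC subrK.
Qed.

End WittRing.

(** * Values and residues of K *)

Section FromWitt.
Variables (R : realType) (p : nat) (k : fieldType) (W : idomainType)
  (coord : W -> nat -> k) (K : fieldExtType {fraction W}) (v : K -> \bar R).
Hypotheses (pp : prime p) (hk : perfect_field p k) (hW : is_witt_ring p coord).
Hypotheses (hv : is_valuation v)
  (hF : is_padic_valuation p (fun a : {fraction W} => v a%:A))
  (tr : totally_ramified v).

Let vF := fun a : {fraction W} => v a%:A.

Let hvF : is_valuation vF. Proof. by case: hF. Qed.

Lemma fracp_neq0 : (p%:R : {fraction W}) != 0.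
Proof.
apply/eqP => e; case: hF => _ + _.
by rewrite e scale0r ((valuation_infty hv 0).2 erefl).
Qed.

Lemma wittp_neq0 : (p%:R : W) != 0.
Proof.
apply: contra_neq fracp_neq0 => e.
by rewrite -(rmorph_nat (@tofrac W)) e rmorph0.
Qed.

Lemma vge_fracP (a : {fraction W}) : vge vF 0 a <-> exists w, a = tofrac w.
Proof. case: hF => _ _; exact. Qed.

Lemma valp_frac : fval vF p%:R = 1.
Proof. by rewrite /fval; case: hF => _ h _; rewrite [vF _]h. Qed.

(** Dividing by a power of p, assume 0 <= v(a) < 1, so that a is in W.  If the
    residue of a is 0 then p divides a, which is excluded by v(a) < 1; otherwise a
    has an inverse modulo p, so v(a) = 0. *)
Lemma val_frac (a : {fraction W}) : a != 0 -> exists n : int, fval vF a = n%:~R.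
Proof.
move=> a0; pose q := Num.floor (fval vF a).
have pq0 := expfz_neq0 q fracp_neq0.
have b0 : a / p%:R ^ q != 0 by rewrite mulf_neq0 ?invr_neq0.
have vb : fval vF (a / p%:R ^ q) = fval vF a - q%:~R.
  rewrite (valM hvF) ?invr_neq0 // (valV hvF) // valXz //; last exact: fracp_neq0.
  by rewrite valp_frac mulr1.
have bge : 0 <= fval vF (a / p%:R ^ q) by rewrite vb subr_ge0 floor_le.
have blt : fval vF (a / p%:R ^ q) < 1.
  by rewrite vb; have := floorD1_gt (fval vF a); rewrite -/q rmorphD /=; lra.
have [w ew] := (vge_fracP _).1 ((vge_val hvF _ b0).2 bge).
exists q; apply/eqP; rewrite -subr_eq0 -vb; apply/eqP.
have w0 : tofrac w != 0 by rewrite -ew.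
rewrite ew in blt bge *.
have [r0|r0] := eqVneq (residue coord w) 0.
  have [w' e] := residue_ker pp hk hW wittp_neq0 r0.
  have w'0 : tofrac w' != 0.
    by apply: contra_neq w0; rewrite e rmorphM /= => ->; rewrite mulr0.
  have : 0 <= fval vF (tofrac w').
    by apply/(vge_val hvF _ w'0)/vge_fracP; exists w'.
  move: blt; rewrite e rmorphM rmorph_nat (valM hvF) ?fracp_neq0 // valp_frac.
  lra.
have [w' [c e]] := residue_inv pp hk hW wittp_neq0 r0.
have c1 : vge vF 1 (p%:R * tofrac c).
  rewrite -[X in vge _ X _]addr0; apply: (vgeM hvF).
    by apply/(vge_val hvF); rewrite ?fracp_neq0 ?valp_frac.
  by apply/vge_fracP; exists c.
have [|] := valDl hvF (oner_neq0 _) c1; first by rewrite (val1 hvF).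
have <- : tofrac (w * w') = 1 + p%:R * tofrac c :> {fraction W}.
  by rewrite e rmorphD rmorphM rmorph1 rmorph_nat.
rewrite (val1 hvF) rmorphM mulf_eq0 negb_or => /andP[_ w'0].
rewrite (valM hvF) // => ww'.
have : 0 <= fval vF (tofrac w').
  by apply/(vge_val hvF _ w'0)/vge_fracP; exists w'.
by move: ww' bge; lra.
Qed.

Lemma val_ext_denom : exists m : nat, (0 < m)%N /\
  forall x : K, x != 0 -> exists a : int, fval v x = a%:~R / m%:R.
Proof.
exists (\dim {:K})`!; split; first exact: fact_gt0.
move=> x x0; set P := minPoly 1%AS x.
have P0 : P != 0 by rewrite monic_neq0 // monic_minPoly.
have Px : root P x by exact: root_minPoly.
have cP l : P`_l != 0 -> exists a : int, fval v P`_l = a%:~R / 1%:R.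
  move=> Pl; have /vlineP[c ec] : P`_l \in 1%VS by exact: (polyOverP (minPolyOver 1%AS x)).
  have c0 : c != 0 by apply: contra_neq Pl => c0; rewrite ec c0 scale0r.
  by have [a ha] := val_frac c0; exists a; rewrite divr1 -ha ec.
have sP : (size P <= (\dim {:K}).+1)%N.
  by rewrite size_minPoly ltnS adjoin_degreeE dimv1 divn1 dimvS // subvf.
by have := root_val hv (ltn0Sn 0) sP P0 Px x0 cP; rewrite muln1.
Qed.

Lemma residue_field_perfect e (pi : K) : (0 < e)%N -> pi != 0 -> fval v pi = e%:R^-1 ->
  (forall x : K, x != 0 -> exists a : int, fval v x = a%:~R / e%:R) ->
  forall x, vge v 0 x -> exists y, vge v 0 y /\ vge v e%:R^-1 (x - y ^+ p).
Proof.
move=> e0 pi0 vpi hval x x0.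
have eR : 0 < (e%:R : R) by rewrite ltr0n.
have e1 : (e%:R^-1 : R) <= 1 by rewrite invf_le1 // ler1n.
have [a ha] := tr x0.
have hxa : vge v e%:R^-1 (x - a%:A).
  apply: (vge_valP hv) => n0; have [c hc] := hval _ n0.
  move: ha; rewrite (v_fin hv) // lte_fin hc pmulr_lgt0 ?invr_gt0 // ltr0z => c0.
  by rewrite -[leLHS]mul1r ler_pM2r ?invr_gt0 // ler1z; lia.
have a0 : vge vF 0 a.
  rewrite -[vge _ _ _]/(vge v 0 a%:A) -[a%:A](subKr x).
  by apply: (vgeB hv) => //; apply: vge_le hxa; rewrite invr_ge0 ltW.
have [w ew] := (vge_fracP _).1 a0.
have [w' [c hw]] := residue_frob pp hk hW wittp_neq0 w.
exists (tofrac w')%:A; split; first by apply/vge_fracP; exists w'.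
rewrite -[x](subrK a%:A) -addrA; apply: (vgeD hv) => //.
rewrite ew hw rmorphD rmorphXn rmorphM rmorph_nat.
rewrite -[((tofrac w')%:A) ^+ p](rmorphXn (in_alg K)) scalerDl addrC addKr.
apply: (@vge_le _ _ _ (1 + 0)); first by rewrite addr0.
rewrite -[vge _ _ _]/(vge vF (1 + 0) (p%:R * tofrac c)).
apply: (vgeM hvF); last by apply/vge_fracP; exists c.
apply/(vge_val hvF _ fracp_neq0); by rewrite valp_frac.
Qed.

End FromWitt.

(** * Binomial congruences and roots of unity of p-power order *)

Section Roots.
Variables (R : realType) (p : nat) (L : fieldType) (v : L -> \bar R).
Hypotheses (pp : prime p) (hv : is_valuation v) (vp : v p%:R = 1%:E).
Notation fval := (fval v). Notation vge := (vge v).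

Lemma pR_neq0 : (p%:R : L) != 0.
Proof. by apply/eqP => e; move: vp; rewrite e ((valuation_infty hv 0).2 erefl). Qed.

Lemma valp : fval p%:R = 1. Proof. by rewrite /fval vp. Qed.

Lemma vge_p : vge 1 p%:R.
Proof. by rewrite /vge vp. Qed.

(** The characteristic is 0: p <> 0 because v(p) is finite, and a natural number
    prime to p is invertible modulo p. *)
Lemma natL_neq0 l : (0 < l)%N -> (l%:R : L) != 0.
Proof.
move=> l0; have [m cop ->] := pfactor_coprime pp l0.
rewrite natrM natrX mulf_neq0 ?expf_neq0 ?pR_neq0 //.
have /(coprimeP _ (prime_gt0 pp))[[a b] /= ab] := cop.
apply/eqP => m0.
have e : (a * p)%N = (b * m + 1)%N by lia.
have := congr1 (fun n => n%:R : L) e; rewrite natrD !natrM m0 mulr0 add0r => ap1.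
have : vge 1 (1%:R : L).
  by rewrite -ap1; apply: vgeM0; [exact: hv|exact: vge_nat|exact: vge_p].
by move/(vge_val hv 1 (oner_neq0 _)); rewrite (val1 hv) ler10.
Qed.

Let p1 : (1 < p)%N := prime_gt1 pp.
Let p0 : (0 < p)%N := prime_gt0 pp.

Lemma pm1_gt0 : 0 < (p%:R - 1 : R).
Proof. by rewrite subr_gt0 ltr1n. Qed.

Lemma val_unit_root m (x : L) : (0 < m)%N -> x ^+ m = 1 -> fval x = 0.
Proof.
move=> m0 xm; have x0 : x != 0.
  by apply/eqP => e; move: xm; rewrite e expr0n (gtn_eqF m0) => /esym/eqP; rewrite oner_eq0.
have := valX hv m x0; rewrite xm (val1 hv) => /esym/eqP.
by rewrite mulf_eq0 pnatr_eq0 (gtn_eqF m0) => /eqP.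
Qed.

(** The inner binomial coefficients are divisible by p. *)
Lemma exprD_p (x u : L) : vge 0 x -> vge 0 u ->
  exists2 w, vge 0 w & (x + u) ^+ p = x ^+ p + u ^+ p + p%:R * u * w.
Proof.
move=> x0 u0; have pE : p = p.-1.+1 by lia.
exists (\sum_(j < p.-1) ('C(p, j.+1) %/ p)%:R * (x ^+ (p - j.+1) * u ^+ j)).
  apply: (vge_sum hv) => j _; apply: (vgeM0 hv); first exact: vge_nat.
  by apply: (vgeM0 hv); exact: vgeX0.
have expand q : (x + u) ^+ q.+1 = x ^+ q.+1 + u ^+ q.+1 +
    \sum_(j < q) (x ^+ (q.+1 - j.+1) * u ^+ j.+1) *+ 'C(q.+1, j.+1).
  rewrite exprDn big_ord_recl big_ord_recr /= subnn subn0 bin0 binn !expr0.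
  by rewrite !mulr1n mul1r mulr1 addrA addrAC.
rewrite {1}pE expand -pE; congr (_ + _).
rewrite mulr_sumr; apply: eq_bigr => j _.
have dv : (p %| 'C(p, j.+1))%N.
  by apply: prime_dvd_bin => //=; have := ltn_ord j; lia.
rewrite -{1}(divnK dv) -[LHS]mulr_natr natrM exprS; ring.
Qed.

Lemma vge_exprD_sub (x u : L) : vge 0 x -> vge 0 u ->
  vge 1 ((x + u) ^+ p - (x ^+ p + u ^+ p)).
Proof.
move=> x0 u0; have [w w0 ->] := exprD_p x0 u0; rewrite addrC addKr.
by apply: (vgeM0r hv) => //; apply: (vgeM0r hv) => //; exact: vge_p.
Qed.

Lemma expr1D_p (u : L) : vge 0 u ->
  exists2 w, vge 0 w & (1 + u) ^+ p = 1 + u ^+ p + p%:R * u * (1 + u * w).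
Proof.
move=> u0; have pE : p = p.-2.+2 by lia.
exists (\sum_(i < p.-2) ('C(p, i.+2) %/ p)%:R * u ^+ i).
  by apply: (vge_sum hv) => i _; apply: (vgeM0 hv); [exact: vge_nat|exact: vgeX0].
have expand q : (1 + u) ^+ q.+2 = 1 + u ^+ q.+2 +
    (q.+2%:R * u + \sum_(i < q) u ^+ i.+2 *+ 'C(q.+2, i.+2)).
  rewrite exprDn 2!big_ord_recl big_ord_recr /= subnn subn0 expr1n !mul1r.
  rewrite expr0 expr1n expr1 bin0 bin1 binn !mulr1n mul1r mulr_natl.
  have -> : \sum_(i < q) 1 ^+ (q.+2 - bump 0 (bump 0 i)) * u ^+ bump 0 (bump 0 i)
      *+ 'C(q.+2, bump 0 (bump 0 i)) = \sum_(i < q) u ^+ i.+2 *+ 'C(q.+2, i.+2).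
    by apply: eq_bigr => j _; rewrite expr1n mul1r.
  by ring.
rewrite {1}pE expand -pE; congr (_ + _).
rewrite mulrDr mulr1 mulrA; congr (_ + _).
rewrite mulr_sumr; apply: eq_bigr => j _.
have dv : (p %| 'C(p, j.+2))%N.
  by apply: prime_dvd_bin => //=; have := ltn_ord j; lia.
rewrite -{1}(divnK dv) mulnC -[LHS]mulr_natr natrM -mulr_natl !exprS; ring.
Qed.

(** With u = x - 1, the equation (1 + u)^p = 1 becomes u^p = - p u (1 + u w), and
    1 + u w is a unit. *)
Lemma val_unity_root1 (x : L) : x ^+ p = 1 -> x != 1 ->
  fval (x - 1) = (p%:R - 1)^-1.
Proof.
move=> xp x1; set u := x - 1.
have u0 : u != 0 by rewrite subr_eq0.
have x0 : x != 0.
  by apply/eqP => e; move: xp; rewrite e expr0n (gtn_eqF p0) => /esym/eqP; rewrite oner_eq0.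
have uge : vge 0 u.
  apply: (vgeB hv); last exact: vge1.
  by apply/(vge_val hv _ x0); rewrite (val_unit_root p0 xp).
have [w w0 E] := expr1D_p uge.
have xE : 1 + u = x by rewrite /u addrC subrK.
have {E}E : u ^+ p = - (p%:R * u * (1 + u * w)).
  by move: E; rewrite xE xp -addrA -{1}[1]addr0 => /addrI/esym/eqP; rewrite addr_eq0 => /eqP.
have p0R : 0 < (p%:R : R) by rewrite ltr0n.
have up : 0 < fval u.
  have : vge 1 (u ^+ p).
    rewrite E; apply/(vgeN hv); apply: vgeM0r => //; first exact: vgeM0r vge_p uge.
    by apply: (vgeD hv); [exact: vge1|exact: vgeM0].
  move/(vgeX_root hv p0)/(vge_val hv _ u0); apply: lt_le_trans.
  by rewrite div1r invr_gt0.
have uw : vge (fval u) (u * w).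
  by apply: (vgeM0r hv) => //; apply/(vge_val hv).
have [|n1 v1] := valDl hv (oner_neq0 L) uw; first by rewrite (val1 hv).
have := congr1 fval E; rewrite (valN hv) (valX hv) // (valM hv) ?mulf_neq0 ?pR_neq0 //.
rewrite (valM hv) ?pR_neq0 // v1 (val1 hv) valp addr0 => h.
have pm := pm1_gt0; apply: (mulfI (lt0r_neq0 pm)).
rewrite mulfV ?lt0r_neq0 // mulrBl mul1r h; lra.
Qed.

(** Going from x^p to x divides the value of x - 1 by p, because
    (1 + u)^p - 1 = u^p modulo p u, and v(p u) exceeds v(x^p - 1) <= 1. *)
Lemma val_unity_root m (x : L) : x ^+ (p ^ m.+1) = 1 -> x ^+ (p ^ m) != 1 ->
  x != 1 /\ fval (x - 1) = ((p ^ m)%:R * (p%:R - 1))^-1.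
Proof.
elim: m x => [|m IH] x xp x1.
  rewrite expn0 expr1 in x1; rewrite expn1 in xp.
  by split=> //; rewrite expn0 mul1r; exact: val_unity_root1.
have [y1 vy] : x ^+ p != 1 /\ fval (x ^+ p - 1) = ((p ^ m)%:R * (p%:R - 1))^-1.
  by apply: IH; rewrite -exprM -expnS.
have x1' : x != 1 by apply: contra_neq y1 => ->; rewrite expr1n.
split=> //; set u := x - 1.
have u0 : u != 0 by rewrite subr_eq0.
have x0 : x != 0.
  apply/eqP => e; move: xp; rewrite e expr0n expn_eq0 (gtn_eqF p0) /= => /esym/eqP.
  by rewrite oner_eq0.
have uge : vge 0 u.
  apply: (vgeB hv); last exact: vge1.
  apply/(vge_val hv _ x0); rewrite (val_unit_root _ xp) //.
  by rewrite expn_gt0 p0.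
have [w w0 E] := expr1D_p uge.
have xE : 1 + u = x by rewrite /u addrC subrK.
set s := p%:R * u * (1 + u * w) in E.
have pm := pm1_gt0.
have p0R : 0 < (p%:R : R) by rewrite ltr0n.
have p2R : 2 <= (p%:R : R) by rewrite (ler_nat _ 2).
have pmR : 1 <= ((p ^ m)%:R : R) by rewrite ler1n expn_gt0 p0.
have yp : 0 < fval (x ^+ p - 1) by rewrite vy invr_gt0 mulr_gt0 //; lra.
have y1' : fval (x ^+ p - 1) <= 1.
  rewrite vy invf_le1 ?mulr_gt0 //; last lra.
  by rewrite -[1]mulr1 ler_pM //; lra.
have y0 : x ^+ p - 1 != 0 by rewrite subr_eq0.
have Eu : u ^+ p = (x ^+ p - 1) + (- s).
  by rewrite -xE E; ring.
have sge c : vge c u -> vge (1 + c) s.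
  move=> hc; apply: (vgeM0r hv); first by apply: (vgeM hv) => //; exact: vge_p.
  by apply: (vgeD hv); [exact: vge1|exact: vgeM0].
have up : 0 < fval u.
  have : vge (Num.min 1 (fval (x ^+ p - 1))) (u ^+ p).
    rewrite Eu; apply: (vgeD hv).
      by apply/(vge_val hv) => //; rewrite ge_min lexx orbT.
    apply/(vgeN hv); have := sge _ uge; rewrite addr0; apply: vge_le.
    by rewrite ge_min lexx.
  move/(vgeX_root hv p0)/(vge_val hv _ u0); apply: lt_le_trans.
  by rewrite divr_gt0 // lt_min ltr01.
have sge' : vge (1 + fval u) (- s) by apply/(vgeN hv)/sge/(vge_val hv).
have [|_] := valDl hv y0 sge'; first by lra.
rewrite -Eu (valX hv) // vy => h.
apply: (mulfI (lt0r_neq0 p0R)); rewrite h expnS natrM; field.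
by rewrite !lt0r_neq0 //=; lra.
Qed.
End Roots.

Lemma closed_rootX (L : closedFieldType) (p : nat) (a : L) : (0 < p)%N ->
  exists b, b ^+ p = a.
Proof.
move=> p0; have s : size ('X^p - a%:P) != 1.
  by rewrite size_XnsubC // eqSS gtn_eqF.
have /closed_rootP[b] := s.
by rewrite rootE !hornerE subr_eq0 => /eqP; exists b.
Qed.

Lemma prim_root_pow (R : realType) (L : closedFieldType) (v : L -> \bar R) p n :
  prime p -> is_valuation v -> v p%:R = 1%:E ->
  exists z : L, z ^+ (p ^ n.+1) = 1 /\ z ^+ (p ^ n) != 1.
Proof.
move=> pp hv vp; have p0 := prime_gt0 pp; have p1 := prime_gt1 pp.
elim: n => [|n [z [z1 z2]]]; last first.
  have [y yz] := closed_rootX z p0.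
  exists y; rewrite expnS exprM yz z1; split=> //.
  by rewrite expnS exprM yz.
pose P : {poly L} := \poly_(i < p) 1.
have sP : size P = p by rewrite size_poly_eq // oner_neq0.
have /closed_rootP[z] : size P != 1 by rewrite sP gtn_eqF.
rewrite /root horner_poly => /eqP z0.
have {}z0 : \sum_(i < p) z ^+ i = 0.
  by rewrite -[RHS]z0; apply: eq_bigr => i _; rewrite mul1r.
have zp : z ^+ p - 1 = 0 by rewrite subrX1 z0 mulr0.
exists z; rewrite expn1 expn0 expr1; split; first by apply/eqP; rewrite -subr_eq0 zp.
apply/eqP => z1; move: z0; rewrite z1.
under eq_bigr => i _ do rewrite expr1n.
rewrite sumr_const card_ord => /eqP; apply/negP; exact: natL_neq0 pp hv vp _ p0.
Qed.

(** * The tower of p-power roots of a uniformizer *)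

Section Arith.
Variables (R : realType) (p : nat).
Hypothesis pp : prime p.
Let p1 : (1 < p)%N := prime_gt1 pp.
Let p0 : (0 < p)%N := prime_gt0 pp.

Lemma small_modz (n : nat) (a a' : int) (j j' : nat) : (j < n)%N -> (j' < n)%N ->
  a * n + j = a' * n + j' -> j = j'.
Proof.
move=> jn j'n /(congr1 (modz^~ (n : int))) /=.
rewrite !modzMDl !modz_nat !modn_small // => e.
by case: e.
Qed.

(** The two sides are the values of [twisted_values_distinct] multiplied by
    e p^n (p-1).  If the p-adic valuations of j and j' differ, let s be the
    smaller one, say of j: all terms but (p-1) j are divisible by p^(s+1). *)
Lemma twisted_values (n e : nat) (a a' : int) (j j' : nat) :
  (0 < j < p ^ n)%N -> (0 < j' < p ^ n)%N ->
  (p - 1)%N%:Z * (a * (p ^ n)%N + j) + (e * p ^ (logn p j).+1)%N =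
  (p - 1)%N%:Z * (a' * (p ^ n)%N + j') + (e * p ^ (logn p j').+1)%N -> j = j'.
Proof.
wlog le : a a' j j' / (logn p j <= logn p j')%N.
  move=> H hj hj' E; have [le|/ltnW le] := leqP (logn p j) (logn p j').
    exact: H E.
  by apply/esym; apply: H (esym E).
move=> /andP[j0 jn] /andP[j'0 j'n] E.
have [eq|lt] := eqVneq (logn p j) (logn p j').
  move: E; rewrite eq => /addIr /mulfI E.
  by apply: (@small_modz (p ^ n) a a') => //; apply: E; lia.
have {le}lt : (logn p j < logn p j')%N by rewrite ltn_neqAle lt.
set s := logn p j in E lt *.
have sn : (s.+1 <= n)%N.
  rewrite -(ltn_exp2l _ _ p1) (leq_ltn_trans _ jn) // dvdn_leq //.
  exact: pfactor_dvdnn.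
have d1 : (p ^ s.+1 %| p ^ n)%N by rewrite dvdn_exp2l.
have d2 : (p ^ s.+1 %| j')%N by rewrite pfactor_dvdn.
have d3 : (p ^ s.+1 %| p ^ (logn p j').+1)%N by rewrite dvdn_exp2l // ltnW.
have : ((p ^ s.+1)%N %| (p - 1)%N%:Z * j)%Z.
  have -> : (p - 1)%N%:Z * j = (p - 1)%N%:Z * (a' - a) * (p ^ n)%N +
      (p - 1)%N%:Z * j' + e%:Z * (p ^ (logn p j').+1)%N - e%:Z * (p ^ s.+1)%N.
    move: E; rewrite !PoszM; lia.
  rewrite rpredB ?rpredD // ?dvdz_mull //.
rewrite -PoszM dvdzE /= Gauss_dvdr; last first.
  by rewrite coprimeXl // coprime_sym subn1 coprimePn.
by rewrite pfactor_dvdn // ltnn.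
Qed.

Lemma pfactor_lt n j : (0 < j < p ^ n)%N -> (logn p j < n)%N.
Proof.
move=> /andP[j0 jn]; rewrite -(ltn_exp2l _ _ p1) (leq_ltn_trans _ jn) //.
by rewrite dvdn_leq // pfactor_dvdnn.
Qed.

(** The value of zeta^j - 1 for zeta of order p^n and 0 < j < p^n. *)
Definition zval n j : R := ((p ^ (n - (logn p j).+1))%:R * (p%:R - 1))^-1.

Lemma zval_le n j : zval n j <= (p%:R - 1)^-1.
Proof.
have pm : 0 < (p%:R - 1 : R) by exact: pm1_gt0.
rewrite /zval lef_pV2 ?posrE ?mulr_gt0 ?ltr0n ?expn_gt0 ?p0 //.
by rewrite -[leLHS]mul1r ler_pM2r // ler1n expn_gt0 p0.
Qed.

Lemma scaled_value (n e : nat) (a : int) (j : nat) : (0 < e)%N ->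
  (a%:~R / e%:R + j%:R / (e%:R * (p ^ n)%:R)) * (e%:R * (p ^ n)%:R) =
  (a * (p ^ n)%N + j)%:~R :> R.
Proof.
move=> e0; have eR : (e%:R : R) != 0 by rewrite pnatr_eq0 -lt0n.
have pR : ((p ^ n)%:R : R) != 0 by rewrite pnatr_eq0 -lt0n expn_gt0 p0.
by rewrite rmorphD rmorphM /= -!pmulrn; field; rewrite eR pR.
Qed.

Lemma values_distinct (n e : nat) (a a' : int) (j j' : nat) : (0 < e)%N ->
  (j < p ^ n)%N -> (j' < p ^ n)%N ->
  a%:~R / e%:R + j%:R / (e%:R * (p ^ n)%:R) =
  a'%:~R / e%:R + j'%:R / (e%:R * (p ^ n)%:R) :> R -> j = j'.
Proof.
move=> e0 jn j'n /(congr1 (fun x => x * (e%:R * (p ^ n)%:R))).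
by rewrite !scaled_value // => /intr_inj; exact: small_modz.
Qed.

Lemma twisted_values_distinct (n e : nat) (a a' : int) (j j' : nat) : (0 < e)%N ->
  (0 < j < p ^ n)%N -> (0 < j' < p ^ n)%N ->
  a%:~R / e%:R + j%:R / (e%:R * (p ^ n)%:R) + zval n j =
  a'%:~R / e%:R + j'%:R / (e%:R * (p ^ n)%:R) + zval n j' -> j = j'.
Proof.
move=> e0 hj hj'.
have eR : (e%:R : R) != 0 by rewrite pnatr_eq0 -lt0n.
have pR k : ((p ^ k)%:R : R) != 0 by rewrite pnatr_eq0 -lt0n expn_gt0 p0.
have pmR : (p%:R - 1 : R) != 0 by rewrite lt0r_neq0 // pm1_gt0.
have zE i : (0 < i < p ^ n)%N ->
    zval n i * (e%:R * (p ^ n)%:R) * (p%:R - 1) = (e * p ^ (logn p i).+1)%N%:R.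
  move=> hi; have lt := pfactor_lt hi.
  rewrite /zval -{2}(subnK lt) expnD !natrM; field.
  by rewrite pmR pR.
have main (b : int) i : (0 < i < p ^ n)%N ->
    (b%:~R / e%:R + i%:R / (e%:R * (p ^ n)%:R) + zval n i) *
      (e%:R * (p ^ n)%:R) * (p%:R - 1) =
    ((p - 1)%N%:Z * (b * (p ^ n)%N + i) + (e * p ^ (logn p i).+1)%N)%:~R :> R.
  move=> hi; rewrite mulrDl mulrDl zE // scaled_value //.
  rewrite [RHS]rmorphD rmorphM /= mulrC; congr (_ * _ + _).
  by rewrite -pmulrn natrB // ltnW.
move=> /(congr1 (fun x => x * (e%:R * (p ^ n)%:R) * (p%:R - 1))).
by rewrite !main // => /intr_inj; exact: twisted_values.
Qed.

End Arith.

Section Tower.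
Variables (R : realType) (p : nat) (K : fieldType) (L : closedFieldType)
  (i : {rmorphism K -> L}) (v : L -> \bar R).
Hypotheses (pp : prime p) (hv : is_valuation v).
Variables (e : nat) (pi : K).
Hypotheses (e0 : (0 < e)%N) (pi0 : pi != 0) (vpi : fval v (i pi) = e%:R^-1)
  (valK : forall x : K, x != 0 -> exists a : int, fval v (i x) = a%:~R / e%:R).
Notation fval := (fval v). Notation vge := (vge v).
Let p1 : (1 < p)%N := prime_gt1 pp.
Let p0 : (0 < p)%N := prime_gt0 pp.

Definition pth_root (a : L) : L := sval (cid (closed_rootX a p0)).

Lemma pth_rootP a : pth_root a ^+ p = a.
Proof. by rewrite /pth_root; case: cid. Qed.

Definition pi_root n : L := iter n pth_root (i pi).

Lemma pi_root_add n m : pi_root (n + m) ^+ (p ^ m) = pi_root n.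
Proof.
elim: m => [|m IH]; first by rewrite addn0 expr1.
by rewrite addnS expnS exprM /= pth_rootP.
Qed.

Lemma pi_root_pow n : pi_root n ^+ (p ^ n) = i pi.
Proof. by have := pi_root_add 0 n. Qed.

Lemma pi_root_neq0 n : pi_root n != 0.
Proof.
apply/eqP => h; have := pi_root_pow n; rewrite h expr0n expn_eq0 gtn_eqF //=.
by move/eqP; rewrite eq_sym fmorph_eq0 (negPf pi0).
Qed.

Lemma pnR n : ((p ^ n)%:R : R) != 0.
Proof. by rewrite pnatr_eq0 -lt0n expn_gt0 p0. Qed.

Let eR : (e%:R : R) != 0. Proof. by rewrite pnatr_eq0 -lt0n. Qed.

Lemma val_pi_root n : fval (pi_root n) = (e%:R * (p ^ n)%:R)^-1.
Proof.
have := valX hv (p ^ n) (pi_root_neq0 n); rewrite pi_root_pow vpi => h.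
by apply: (mulfI (pnR n)); rewrite -h; field; rewrite eR pnR.
Qed.

Lemma val_term n (x : K) j : x != 0 -> exists a : int,
  fval (i x * pi_root n ^+ j) = a%:~R / e%:R + j%:R / (e%:R * (p ^ n)%:R).
Proof.
move=> x0; have [a ha] := valK x0; exists a.
rewrite (valM hv) ?fmorph_eq0 ?expf_neq0 ?pi_root_neq0 // ha (valX hv) ?pi_root_neq0 //.
by rewrite val_pi_root.
Qed.

Lemma tower_reduce n (P : {poly K}) : exists Q : {poly K},
  (size Q <= p ^ n)%N /\ exists q, P = q * ('X^(p ^ n) - pi%:P) + Q.
Proof.
have pn : (0 < p ^ n)%N by rewrite expn_gt0 p0.
exists (modp P ('X^(p ^ n) - pi%:P)); split.
  rewrite -ltnS -(size_XnsubC pi pn) ltn_modp -size_poly_eq0.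
  by rewrite size_XnsubC.
by exists (divp P ('X^(p ^ n) - pi%:P)); exact: divp_eq.
Qed.

Lemma horner_tower n (Q : {poly K}) x : (size Q <= p ^ n)%N ->
  (map_poly i Q).[x] = \sum_(j < p ^ n) i Q`_j * x ^+ j.
Proof.
move=> sQ; rewrite (@horner_coef_wide _ (p ^ n)) ?size_map_poly //.
by apply: eq_bigr => j _; rewrite coef_map.
Qed.

Lemma horner_reduce n (P q Q : {poly K}) x : x ^+ (p ^ n) = i pi ->
  P = q * ('X^(p ^ n) - pi%:P) + Q -> (map_poly i P).[x] = (map_poly i Q).[x].
Proof.
move=> hx ->; rewrite rmorphD rmorphM rmorphB /= map_polyXn map_polyC /=.
by rewrite !hornerE hx subrr mulr0 add0r.
Qed.

Lemma tower_expand n (P : {poly K}) : exists Q : {poly K},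
  (map_poly i P).[pi_root n] = \sum_(j < p ^ n) i Q`_j * pi_root n ^+ j.
Proof.
have [Q [sQ [q hq]]] := tower_reduce n P; exists Q.
by rewrite (horner_reduce (pi_root_pow n) hq) (@horner_tower n).
Qed.

Lemma term_neq0 (x : K) y : i x * y != 0 -> x != 0.
Proof. by apply: contra_neq => ->; rewrite rmorph0 mul0r. Qed.

Lemma tower_distinct n (Q : {poly K}) (a b : 'I_(p ^ n)) : a != b ->
  i Q`_a * pi_root n ^+ a != 0 -> i Q`_b * pi_root n ^+ b != 0 ->
  fval (i Q`_a * pi_root n ^+ a) != fval (i Q`_b * pi_root n ^+ b).
Proof.
move=> ab /term_neq0 a0 /term_neq0 b0; apply: contra_neq ab => h.
have [[c hc] [d hd]] := (val_term n a a0, val_term n b b0).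
apply/val_inj/(values_distinct pp e0 (ltn_ord a) (ltn_ord b) (a := c) (a' := d) (R := R)).
by rewrite -hc -hd.
Qed.

(** The powers pi_n^j, j < p^n, have values that are distinct modulo the values
    of K. *)
Lemma tower_terms n r (Q : {poly K}) :
  vge r (\sum_(j < p ^ n) i Q`_j * pi_root n ^+ j) ->
  forall j : 'I_(p ^ n), vge r (i Q`_j * pi_root n ^+ j).
Proof.
move=> h j; apply: (vge_sum_distinct hv _ h) => // a b _ _.
exact: tower_distinct.
Qed.

(** The polynomial X^(p^n) - pi is minimal for pi_n, since a polynomial of smaller
    degree has terms of distinct values at pi_n. *)
Lemma tower_conj n x (P : {poly K}) : x ^+ (p ^ n) = i pi ->
  root (map_poly i P) (pi_root n) -> root (map_poly i P) x.
Proof.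
move=> hx; have [Q [sQ [q hq]]] := tower_reduce n P.
rewrite /root (horner_reduce (pi_root_pow n) hq) (horner_reduce hx hq) !(@horner_tower n) //.
move=> /eqP h; have z := sum_distinct_eq0 hv (fun a b _ _ => @tower_distinct n Q a b) h.
rewrite big1 // => j _; have /eqP := z j isT.
by rewrite mulf_eq0 expf_eq0 (negPf (pi_root_neq0 n)) andbF orbF => /eqP ->; rewrite mul0r.
Qed.

End Tower.

(** * The union of the tower *)

Section Limit.
Variables (R : realType) (p : nat) (K : fieldType) (L : closedFieldType)
  (i : {rmorphism K -> L}) (v : L -> \bar R).
Hypotheses (pp : prime p) (hv : is_valuation v) (vp : v p%:R = 1%:E)
  (alg : forall z, algebraicOver i z).
Variables (e : nat) (pi : K).
Hypotheses (e0 : (0 < e)%N) (pi0 : pi != 0) (vpi : fval v (i pi) = e%:R^-1)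
  (valK : forall x : K, x != 0 -> exists a : int, fval v (i x) = a%:~R / e%:R).
Notation fval := (fval v). Notation vge := (vge v).
Local Notation pi_root := (pi_root i pp pi).
Let p1 : (1 < p)%N := prime_gt1 pp.
Let p0 : (0 < p)%N := prime_gt0 pp.
Let eR : (e%:R : R) != 0. Proof. by rewrite pnatr_eq0 -lt0n. Qed.
Let eR0 : 0 < (e%:R : R). Proof. by rewrite ltr0n. Qed.

Definition Kinf (z : L) : Prop := exists n (P : {poly K}), z = (map_poly i P).[pi_root n].

Lemma Kinf_lift n m (P : {poly K}) :
  (map_poly i P).[pi_root n] = (map_poly i (P \Po 'X^(p ^ m))).[pi_root (n + m)].
Proof. by rewrite map_comp_poly horner_comp map_polyXn hornerXn pi_root_add. Qed.

Lemma Kinf2 x y : Kinf x -> Kinf y -> exists n (P Q : {poly K}),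
  x = (map_poly i P).[pi_root n] /\ y = (map_poly i Q).[pi_root n].
Proof.
move=> [n [P ->]] [m [Q ->]]; exists (n + m)%N.
exists (P \Po 'X^(p ^ m)), (Q \Po 'X^(p ^ n)).
by rewrite (Kinf_lift n m) (Kinf_lift m n) [(m + n)%N]addnC.
Qed.

Lemma KinfB x y : Kinf x -> Kinf y -> Kinf (x - y).
Proof.
move=> hx hy; have [n [P [Q [-> ->]]]] := Kinf2 hx hy.
by exists n, (P - Q); rewrite rmorphB hornerD hornerN.
Qed.

Lemma KinfM x y : Kinf x -> Kinf y -> Kinf (x * y).
Proof.
move=> hx hy; have [n [P [Q [-> ->]]]] := Kinf2 hx hy.
by exists n, (P * Q); rewrite rmorphM hornerM.
Qed.

Lemma Kinf_base a : Kinf (i a).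
Proof. by exists 0, a%:P; rewrite map_polyC hornerC. Qed.

Lemma Kinf_pi_root n : Kinf (pi_root n).
Proof. by exists n, 'X; rewrite map_polyX hornerX. Qed.

Lemma Kinf1 : Kinf 1. Proof. by rewrite -(rmorph1 i); exact: Kinf_base. Qed.

Lemma KinfD x y : Kinf x -> Kinf y -> Kinf (x + y).
Proof.
move=> hx hy; have [n [P [Q [-> ->]]]] := Kinf2 hx hy.
by exists n, (P + Q); rewrite rmorphD hornerD.
Qed.

Lemma inv_poly z : exists q : {poly K}, z^-1 = (map_poly i q).[z].
Proof.
have [->|z0] := eqVneq z 0; first by exists 0; rewrite invr0 rmorph0 horner0.
have [M M0 hM] := min_polyP (alg z).
have Mz : root (map_poly i M) z by apply/hM; exact: dvdpp.
have [q eq] : exists q, M = q * 'X + (M`_0)%:P.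
  exists (\poly_(k < (size M).-1) M`_k.+1); apply/polyP => -[|k].
    by rewrite coefD coefMX coefC add0r.
  rewrite coefD coefMX coefC /= addr0 coef_poly; case: ltnP => // h.
  by rewrite nth_default //; move: h; case: (size M).
set c := M`_0 in eq.
have zq : z * (map_poly i q).[z] = - i c.
  move: Mz; rewrite {1}eq rmorphD rmorphM /= map_polyX map_polyC /root !hornerE /=.
  by rewrite mulrC addr_eq0 => /eqP.
have c0 : c != 0.
  apply/eqP => c0; move: zq; rewrite c0 rmorph0 oppr0 => /eqP.
  rewrite mulf_eq0 (negPf z0) /= => qz.
  have /dvdpP[u hu] : M %| q by apply/hM.
  have q0 : q != 0 by apply: contra_neq M0 => q0; rewrite eq q0 c0 polyC0 mul0r addr0.
  move/(congr1 (fun P : {poly K} => size P)): eq; rewrite c0 polyC0 addr0.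
  rewrite size_mulX // => sM.
  have : M %| q by apply/dvdpP; exists u.
  by move/(dvdp_leq q0); rewrite sM ltnn.
exists (- c^-1 *: q); rewrite linearZ /= hornerZ rmorphN fmorphV.
by apply: (mulfI z0); rewrite mulfV // mulrCA zq mulrNN mulVf // fmorph_eq0.
Qed.

Lemma KinfV x : Kinf x -> Kinf x^-1.
Proof.
move=> [n [P ->]]; have [q ->] := inv_poly (map_poly i P).[pi_root n].
by exists n, (q \Po P); rewrite map_comp_poly horner_comp.
Qed.

Lemma Kinf_div x y : Kinf x -> Kinf y -> Kinf (x / y).
Proof. by move=> hx hy; apply: KinfM => //; exact: KinfV. Qed.

Lemma KinfX x n : Kinf x -> Kinf (x ^+ n).
Proof.
move=> hx; elim: n => [|n IH]; first exact: Kinf1.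
by rewrite exprS; exact: KinfM.
Qed.

Hypothesis frobK : forall x, vge 0 (i x) ->
  exists y, vge 0 (i y) /\ vge e%:R^-1 (i (x - y ^+ p)).

Definition frob_image (z : L) : Prop :=
  exists t, [/\ Kinf t, vge 0 t & vge 1 (z - t ^+ p)].

Lemma frob_image_int z : frob_image z -> vge 0 z.
Proof.
move=> [t [_ t0 h]]; rewrite -[z](subrK (t ^+ p)); apply: (vgeD hv).
  exact: vge_le ler01 h.
exact: vgeX0.
Qed.

Lemma frob_imageD z z' : frob_image z -> frob_image z' -> frob_image (z + z').
Proof.
move=> [t [Et t0 h]] [t' [Et' t'0 h']]; exists (t + t'); split.
- exact: KinfD.
- exact: vgeD.
apply: (vge_trans hv) (vgeBC hv (vge_exprD_sub pp hv vp t0 t'0)).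
by rewrite opprD addrACA; exact: vgeD.
Qed.

Lemma frob_imageM z z' : frob_image z -> frob_image z' -> frob_image (z * z').
Proof.
move=> hz hz'; have z'0 := frob_image_int hz'.
case: hz hz' => [t [Et t0 h]] [t' [Et' t'0 h']]; exists (t * t'); split.
- exact: KinfM.
- exact: (vgeM0 hv).
have -> : z * z' - (t * t') ^+ p = (z - t ^+ p) * z' + t ^+ p * (z' - t' ^+ p).
  by rewrite exprMn; ring.
apply: (vgeD hv); first exact: vgeM0r.
by apply: (vgeM0 hv) => //; exact: vgeX0.
Qed.

Lemma frob_image1 z : vge 1 z -> frob_image z.
Proof.
exists 0; split; last by rewrite expr0n gtn_eqF // subr0.
  by rewrite -(rmorph0 i); exact: Kinf_base.
exact: vge0.
Qed.

Lemma frob_imageXp t : Kinf t -> vge 0 t -> frob_image (t ^+ p).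
Proof. by move=> Et t0; exists t; rewrite subrr; split=> //; exact: vge0. Qed.

Lemma pi_root_int n : vge 0 (pi_root n).
Proof.
apply/(vge_val hv); first exact: pi_root_neq0.
by rewrite (val_pi_root pp hv e0 pi0 vpi) invr_ge0 mulr_ge0.
Qed.

Lemma frob_image_pi_root n : frob_image (pi_root n).
Proof.
have := pi_root_add i pp pi n 1; rewrite expn1 => <-.
by apply: frob_imageXp; [exact: Kinf_pi_root|exact: pi_root_int].
Qed.

Lemma frob_imageX z n : frob_image z -> frob_image (z ^+ n).
Proof.
move=> hz; elim: n => [|n IH]; last by rewrite exprS; exact: frob_imageM.
rewrite expr0 -(expr1n L p); apply: frob_imageXp; [exact: Kinf1|exact: vge1].
Qed.

(** Expand x in powers of pi, with p-th powers as digits, up to the e-th power,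
    whose value is 1. *)
Lemma frob_image_base x : vge 0 (i x) -> frob_image (i x).
Proof.
have main m : forall x, vge 0 (i x) -> exists z x',
    [/\ frob_image z, vge 0 (i x') & i x = z + i pi ^+ m * i x'].
  elim: m => [|m IH] {}x x0.
    exists 0, x; rewrite add0r expr0 mul1r; split=> //.
    by apply: frob_image1; exact: vge0.
  have [y [y0 hy]] := frobK x0.
  have h1 : vge 0 (i ((x - y ^+ p) / pi)).
    rewrite rmorphM fmorphV; have -> : (0 : R) = e%:R^-1 + - e%:R^-1 by rewrite subrr.
    apply: (vgeM hv) => //; apply/(vge_val hv); first by rewrite invr_eq0 fmorph_eq0.
    by rewrite (valV hv) ?fmorph_eq0 // vpi.
  have [z [x' [hz hx' E]]] := IH _ h1.
  exists (i y ^+ p + i pi * z), x'; split=> //.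
    apply: frob_imageD; first by apply: frob_imageXp => //; exact: Kinf_base.
    apply: frob_imageM => //; exact: (frob_image_pi_root 0).
  rewrite exprS -mulrA -addrA -mulrDr -E -rmorphM mulrC divfK // -rmorphXn -rmorphD.
  by rewrite addrC subrK.
move=> x0; have [z [x' [hz hx' ->]]] := main e _ x0.
apply: frob_imageD => //; apply: frob_image1; apply: (vgeM0r hv) => //.
apply/(vge_val hv); first by rewrite expf_neq0 ?fmorph_eq0.
by rewrite (valX hv) ?fmorph_eq0 // vpi divff.
Qed.

(** The terms of an integral sum of x_j pi_n^j are integral; as the value of pi_n^j
    is less than 1/e, so are the x_j. *)
Lemma frob_image_Kinf z : Kinf z -> vge 0 z -> frob_image z.
Proof.
move=> [n [P ->]]; have [Q ->] := tower_expand i pp pi n P.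
move=> /(tower_terms hv e0 pi0 vpi valK) h.
have h0 : frob_image 0 by apply: frob_image1; exact: vge0.
apply: big_ind => //; first exact: frob_imageD.
move=> j _; have := h j; set x := Q`_j => hx.
apply: frob_imageM; last by apply: frob_imageX; exact: frob_image_pi_root.
apply: frob_image_base; apply: (vge_valP hv); rewrite fmorph_eq0 => x0.
have [a ha] := val_term pp hv e0 pi0 vpi valK n j x0.
move: hx; rewrite vge_val ?mulf_neq0 ?fmorph_eq0 ?expf_neq0 ?pi_root_neq0 // ha.
have [a' ha'] := valK x0; move: ha.
rewrite (valM hv) ?fmorph_eq0 ?expf_neq0 ?pi_root_neq0 //.
rewrite (valX hv) ?pi_root_neq0 // (val_pi_root pp hv e0 pi0 vpi) ha'.
have pnR0 : 0 < ((p ^ n)%:R : R) by rewrite ltr0n expn_gt0 p0.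
move/addIr => <-.
have lt1 : j%:R / (e%:R * (p ^ n)%:R) < e%:R^-1 :> R.
  rewrite ltr_pdivrMr ?mulr_gt0 // mulrA mulVf // mul1r ltr_nat; exact: ltn_ord.
move=> ge; have : -1 < (a'%:~R : R).
  rewrite -(ltr_pM2r (x := e%:R^-1)) ?invr_gt0 // mulN1r; lra.
rewrite -[-1]/((-1)%:~R) ltr_int => a'0.
by rewrite divr_ge0 ?(ltW eR0) // ler0z; lia.
Qed.

(** The powers of pi_n have the multiples of 1/(e p^n) as values. *)
Lemma Kinf_dense (a eps : R) : 0 < eps ->
  exists y, [/\ Kinf y, y != 0, a - eps <= fval y & fval y <= a].
Proof.
move=> eps0.
have [n hn] : exists n, (e%:R * (p ^ n)%:R)^-1 <= eps :> R.
  exists (Num.truncn eps^-1).+1.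
  set n := (Num.truncn _).+1.
  have h : eps^-1 < n%:R by rewrite /n; exact: truncnS_gt.
  have h2 : (n%:R : R) <= e%:R * (p ^ n)%:R.
    rewrite -natrM ler_nat; apply: leq_trans (leq_pmull _ e0).
    by rewrite ltnW // ltn_expl.
  rewrite -[eps]invrK lef_pV2 ?posrE ?invr_gt0 //.
    by rewrite (le_trans _ h2) // ltW.
  by rewrite (lt_le_trans _ h2) // ltr0n.
set d : R := (e%:R * (p ^ n)%:R)^-1 in hn.
have d0 : 0 < d by rewrite invr_gt0 mulr_gt0 // ltr0n expn_gt0 p0.
pose q := Num.floor (a / d).
exists (pi_root n ^ q); split.
- have Ep := Kinf_pi_root n; case: (q) => m; first by rewrite -exprnP; exact: KinfX.
  by rewrite NegzE -exprnN; apply/KinfV/KinfX.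
- by rewrite expfz_neq0 // pi_root_neq0.
- rewrite valXz ?pi_root_neq0 // (val_pi_root pp hv e0 pi0 vpi) -/d.
  have := floorD1_gt (a / d); rewrite -/q ltr_pdivrMr // rmorphD mulrDl mul1r; lra.
- rewrite valXz ?pi_root_neq0 // (val_pi_root pp hv e0 pi0 vpi) -/d.
  by rewrite -ler_pdivlMr //; exact: floor_le.
Qed.

End Limit.

(** * Approximation over the union of the tower *)

(** Lagrange interpolation at the points rs, evaluated at 0. *)
Lemma interpolation0 (L : fieldType) (rs : seq L) : uniq rs ->
  exists l : L -> L, forall Q : {poly L}, (size Q <= size rs)%N ->
    Q.[0] = \sum_(r <- rs) l r * Q.[r].
Proof.
elim: rs => [|r rs IH] /=.
  by move=> _; exists id => Q; rewrite leqn0 size_poly_eq0 => /eqP ->; rewrite horner0 big_nil.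
move=> /andP[nr /IH[l hl]].
exists (fun t => if t == r then 1 + r * \sum_(t <- rs) l t / (t - r)
                 else - r * l t / (t - r)) => Q sQ.
have : root (Q - Q.[r]%:P) r by rewrite /root !hornerE subrr.
case/factor_theorem => Q1 hQ1.
have sQ1 : (size Q1 <= size rs)%N.
  have [->|Q10] := eqVneq Q1 0; first by rewrite size_poly0.
  have sM : size (Q1 * ('X - r%:P)) = (size Q1).+1.
    by rewrite size_Mmonic ?monicXsubC // size_XsubC addn2.
  rewrite -ltnS -sM -hQ1; apply: leq_trans (size_polyD _ _) _.
  by rewrite size_polyN geq_max sQ (leq_trans (size_polyC_leq1 _)).
have QE t : Q.[t] = Q.[r] + Q1.[t] * (t - r).
  have := congr1 (fun P => P.[t]) hQ1; rewrite /= !hornerE => <-.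
  by rewrite addrC subrK.
rewrite big_cons eqxx.
have -> : \sum_(t <- rs) (if t == r then 1 + r * \sum_(t <- rs) l t / (t - r)
                 else - r * l t / (t - r)) * Q.[t] =
  \sum_(t <- rs) (- r * (Q.[r] * (l t / (t - r)) + l t * Q1.[t])).
  apply: eq_big_seq => t tr; have tr0 : t != r by apply: contraNneq nr => <-.
  rewrite (negPf tr0) {1}QE; field.
  by rewrite subr_eq0.
rewrite -mulr_sumr big_split -mulr_sumr /= -hl // (QE 0); ring.
Qed.

Lemma vge_seq (R : realType) (L : fieldType) (v : L -> \bar R) (T : eqType)
  (rs : seq T) (l : T -> L) : is_valuation v ->
  exists2 c : R, 0 <= c & forall r, r \in rs -> vge v (- c) (l r).
Proof.
move=> hv; elim: rs => [|r rs [c c0 hc]]; first by exists 0.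
exists (Num.max c (- fval v (l r))); first by rewrite le_max c0.
move=> t; rewrite inE => /orP[/eqP ->|/hc].
  by apply: (vge_valP hv) => _; rewrite lerNl le_max lexx orbT.
by apply: vge_le; rewrite lerN2 le_max lexx.
Qed.

Section Boot.
Variables (R : realType) (p : nat) (K : fieldType) (L : closedFieldType)
  (i : {rmorphism K -> L}) (v : L -> \bar R).
Hypotheses (pp : prime p) (hv : is_valuation v) (vp : v p%:R = 1%:E)
  (alg : forall z, algebraicOver i z).
Variables (E : fieldType) (f : {rmorphism E -> L}).
Notation fval := (fval v). Notation vge := (vge v).
Let p0 : (0 < p)%N := prime_gt0 pp.
Hypotheses (fi : forall a, exists d, f d = i a)
  (frobE : forall a, vge 0 (f a) -> exists t, vge 0 (f t) /\ vge 1 (f a - f t ^+ p))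
  (denseE : forall a eps : R, 0 < eps -> exists y, [/\ y != 0, a - eps <= fval (f y) & fval (f y) <= a]).

Lemma algE z : algebraicOver f z.
Proof.
have [P P0 Pz] := alg z.
have [u hu] := choice fi.
pose Q := \poly_(k < size P) u P`_k.
have e : map_poly f Q = map_poly i P.
  apply/polyP => k; rewrite !coef_map coef_poly.
  have [kp|kp] := ltnP k (size P); first exact: hu.
  by rewrite nth_default //; exact: (etrans (rmorph0 f) (esym (rmorph0 i))).
exists Q; last by rewrite e.
apply: contra_neq P0 => q0; apply/eqP.
by rewrite -(map_poly_eq0 i) -e q0 rmorph0.
Qed.

Definition fixes (s : field_aut i) := forall a, s (f a) = f a.

Definition moves_within (z : L) (A : R) :=
  forall s : field_aut i, fixes s -> vge A (s z - z).

Variable x0 : L.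
Definition in_ext (z : L) := exists Q : {poly E}, z = (map_poly f Q).[x0].
(** The property of Ax's theorem for the field E, restricted to the elements of
    E(x0): one constant for a fixed finite extension. *)
Definition ax_ext (c : R) := forall z A, in_ext z -> moves_within z A ->
  exists y, vge (A - c) (z - f y).

Lemma aut_horner (s : field_aut i) (Q : {poly E}) x : fixes s ->
  s (map_poly f Q).[x] = (map_poly f Q).[s x].
Proof.
move=> fs; rewrite -horner_map -map_poly_comp; congr (_.[_]).
by apply: eq_map_poly => a; exact: fs.
Qed.

(** Let z = Q(x0) with deg Q less than the degree of x0 over E.  Then y = Q(0) is a
    combination of the Q(r), r conjugate to x0, whose coefficients l_r depend only
    on x0 and have sum 1; since each Q(r) is a conjugate of z, this gives
    v(y - z) >= A + min v(l_r). *)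
Lemma crude_ax : exists2 c, 0 <= c & ax_ext c.
Proof.
have [M M0 hM] := min_polyP (algE x0).
have Mx : root (map_poly f M) x0 by apply/hM; exact: dvdpp.
have [rs hrs] := closed_field_poly_normal (map_poly f M).
set lc := lead_coef _ in hrs.
have lc0 : lc != 0 by rewrite lead_coef_eq0 map_poly_eq0.
have rsP r : (r \in rs) = root (map_poly f M) r.
  by rewrite hrs rootZ // root_prod_XsubC.
have sM : size M = (size rs).+1.
  by rewrite -(size_map_poly f) hrs size_scale // size_prod_XsubC.
have rs0 : (0 < size rs)%N by have := rsP x0; rewrite Mx; case: (rs).
have M'0 : M^`() != 0.
  apply/eqP => /(congr1 (fun P : {poly E} => P`_(size rs).-1)) /eqP.
  rewrite coef0 coef_deriv prednK // -mulr_natr mulf_eq0.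
  rewrite -[size rs]/((size rs).+1.-1) -sM -lead_coefE lead_coef_eq0 (negPf M0) /=.
  rewrite -(fmorph_eq0 f) rmorph_nat; apply/negP; apply: (natL_neq0 pp hv vp).
  by rewrite sM.
have urs : uniq rs.
  rewrite -separable_prod_XsubC.
  have : separable_poly (map_poly f M).
    rewrite separable_map unlock coprimep_sym.
    apply: (min_poly_coprime M0 hM) => /hM /(dvdp_leq M'0).
    by apply/negP; rewrite -ltnNge lt_size_deriv.
  by rewrite hrs unlock derivZ coprimepZl // coprimepZr.
have [l hl] := interpolation0 urs.
have [c c0 hc] := vge_seq rs l hv.
exists c => // _ A [Q ->] zA.
pose Q' := modp Q M.
have QQ' r : root (map_poly f M) r -> (map_poly f Q).[r] = (map_poly f Q').[r].
  move=> Mr; rewrite {1}(divp_eq Q M) rmorphD rmorphM /= hornerD hornerM.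
  by rewrite (rootP Mr) mulr0 add0r.
have sQ' : (size (map_poly f Q') <= size rs)%N.
  by rewrite size_map_poly -ltnS -sM ltn_modp.
exists Q'.[0]; apply: (vgeBC hv).
have suml : \sum_(r <- rs) l r = 1.
  have := hl 1; rewrite size_poly1 rs0 hornerC => /(_ isT) ->.
  by apply: eq_bigr => r _; rewrite hornerC mulr1.
have -> : f Q'.[0] = \sum_(r <- rs) l r * (map_poly f Q').[r].
  by rewrite -hl // -horner_map rmorph0.
rewrite -[X in _ - X]mul1r -suml mulr_suml -sumrB big_seq_cond.
apply: (vge_sum hv) => r /andP[rrs _]; rewrite -mulrBr addrC.
apply: (vgeM hv); first exact: hc.
have Mr : root (map_poly f M) r by rewrite -rsP.
have [|s [fs sx]] := conj_aut (x := x0) (x' := r) fi algE.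
  by move=> P; apply: (min_poly_conj M0 hM Mr P).1.
rewrite -QQ' // -sx -aut_horner //; exact: zA.
Qed.

Lemma ax_ext_le c c' : c <= c' -> ax_ext c -> ax_ext c'.
Proof.
move=> cc' h z A zx zA; have [y hy] := h z A zx zA.
by exists y; apply: vge_le hy; lra.
Qed.

(** The best m is min((p-1)c, 1); d > 0 absorbs the fact that the value group of
    E need only be dense. *)
Lemma ax_improve c m d : ax_ext c -> 0 <= c -> 0 < d -> 0 <= m -> m <= 1 ->
  m <= (p%:R - 1) * c -> ax_ext (c - m / p%:R + d).
Proof.
move=> H c0 d0 m0 m1 mc z A [Q ez] zA.
have pR : 0 < (p%:R : R) by rewrite ltr0n.
have [y1 hy1] := H z A (ex_intro _ Q ez) zA.
have [a [a0 a1 a2]] := denseE (A - c) d0.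
have fa0 : f a != 0 by rewrite fmorph_eq0.
(* z' is integral, and moved by c at least *)
pose z' := (z - f y1) / f a.
have fz s : fixes s -> s z' - z' = (s z - z) / f a.
  move=> fs; rewrite /z' rmorphM fmorphV rmorphB /= !fs -mulrBl.
  by congr (_ / _); ring.
have vinv r x : vge r x -> vge (r - fval (f a)) (x / f a).
  move=> hx; apply: (vgeM hv) => //; apply/(vge_val hv); first by rewrite invr_eq0.
  by rewrite (valV hv).
have z'0 : vge 0 z'.
  by apply: vge_le (vinv _ _ hy1); lra.
have z'c s : fixes s -> vge c (s z' - z').
  move=> fs; rewrite fz //; apply: vge_le (vinv _ _ (zA s fs)); lra.
have cp : vge 1 (p%:R : L) by exact: vge_p vp.
(* (z' + u)^p - z'^p = u^p mod p u, and both u^p and p u have value >= c + m *)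
have z'p : moves_within (z' ^+ p) (c + m).
  move=> s fs; rewrite rmorphXn.
  set u := s z' - z'; have hu : vge c u := z'c s fs.
  have u0 : vge 0 u by exact: vge_le c0 hu.
  have -> : s z' ^+ p = (z' + u) ^+ p by rewrite /u addrC subrK.
  have [w w0 ->] : exists2 w, vge 0 w & (z' + u) ^+ p = z' ^+ p + u ^+ p + p%:R * u * w.
    exact: exprD_p.
  rewrite [X in vge _ X](_ : _ = u ^+ p + p%:R * u * w); last by ring.
  apply: (vgeD hv).
    by apply: vge_le (vgeX hv p hu); lra.
  apply: (vgeM0r hv) => //.
  by apply: vge_le (vgeM hv cp hu); lra.
have [y2 hy2] : exists y2, vge (c + m - c) (z' ^+ p - f y2).
  apply: H => //; exists ((a^-1 *: (Q - y1%:P)) ^+ p).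
  rewrite rmorphXn horner_exp /= map_polyZ hornerZ fmorphV rmorphB /= map_polyC.
  by rewrite hornerD hornerN hornerC -ez mulrC.
have {}hy2 : vge m (z' ^+ p - f y2) by apply: vge_le hy2; lra.
have y20 : vge 0 (f y2).
  rewrite -[f y2](subKr (z' ^+ p)); apply: (vgeB hv); first exact: vgeX0.
  exact: vge_le m0 hy2.
have [t [t0 ht]] := frobE y20.
have h1 : vge m (z' ^+ p - f t ^+ p).
  by apply: (vge_trans hv) hy2 _; exact: vge_le m1 ht.
(* modulo p, the p-th power of a difference is the difference of p-th powers *)
have h2 : vge m ((z' - f t) ^+ p).
  have := vge_exprD_sub pp hv vp (vgeB hv z'0 t0) t0; rewrite subrK => h.
  have -> : (z' - f t) ^+ p = (z' ^+ p - f t ^+ p) -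
      (z' ^+ p - ((z' - f t) ^+ p + f t ^+ p)) by ring.
  by apply: (vgeB hv) => //; exact: vge_le m1 h.
have h3 := vgeX_root hv p0 h2.
exists (y1 + a * t).
have -> : z - f (y1 + a * t) = f a * (z' - f t).
  by rewrite rmorphD rmorphM /z'; field.
apply: vge_le (vgeM hv ((vge_val hv _ fa0).2 (lexx _)) h3).
by lra.
Qed.

(** As long as the constant exceeds eps, [ax_improve] lowers it by the fixed amount
    d. *)
Lemma ax_ext_eps eps : 0 < eps -> ax_ext eps.
Proof.
move=> eps0; have [c0 c00 H0] := crude_ax.
have pR : 0 < (p%:R : R) by rewrite ltr0n.
have pR2 : 2 <= (p%:R : R) by rewrite (ler_nat _ 2) prime_gt1.
pose m := Num.min (eps / p%:R) 1.
have m0 : 0 < m by rewrite lt_min divr_gt0 //= ltr01.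
have m1 : m <= 1 by rewrite ge_min lexx orbT.
have me : m <= eps / p%:R by rewrite ge_min lexx.
have ep : eps / p%:R <= eps by rewrite ler_pdivrMr // ler_peMr ?(ltW eps0) //; lra.
pose d := m / p%:R / 2.
have d0 : 0 < d by rewrite !divr_gt0.
have mp : m / p%:R <= m by rewrite ler_pdivrMr // ler_peMr ?(ltW m0) //; lra.
have step k : forall c, 0 <= c -> ax_ext c -> c <= eps + k%:R * d -> ax_ext eps.
  elim: k => [|k IH] c cge H hc; first by apply: ax_ext_le H; lra.
  have [le|lt] := lerP c eps; first exact: ax_ext_le H.
  have H' := ax_improve H cge d0 (ltW m0) m1 _.
  apply: (IH (c - m / p%:R + d)).
  - rewrite /d; lra.
  - apply: H'; apply: le_trans me _; apply: le_trans ep _; apply: le_trans (ltW lt) _.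
    by rewrite ler_peMl //; lra.
  - by move: hc; rewrite mulrSr mulrDl mul1r /d; lra.
apply: (step (Num.truncn (c0 / d)).+1 c0) => //.
have := truncnS_gt (c0 / d); rewrite ltr_pdivrMr //; lra.
Qed.

End Boot.

(** * Descent to K and the optimal constant *)

Lemma pow_coprime_eq1 (L : fieldType) (p u : nat) (w : L) : (0 < p)%N ->
  coprime p u -> w ^+ p = 1 -> w ^+ u = 1 -> w = 1.
Proof.
move=> p0 /(coprimeP _ p0)[[a b] /= ab] wp wu.
have e : (p * a)%N = (u * b + 1)%N by lia.
by have := congr1 (fun n => w ^+ n) e; rewrite /= exprD !exprM wp wu !expr1n mul1r expr1.
Qed.

Section Core.
Variables (R : realType) (p : nat) (K : fieldType) (L : closedFieldType)
  (i : {rmorphism K -> L}) (v : L -> \bar R).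
Hypotheses (pp : prime p) (hv : is_valuation v) (vp : v p%:R = 1%:E)
  (alg : forall z, algebraicOver i z)
  (iso : forall (s : field_aut i) z, v (s z) = v z).
Variables (e : nat) (pi : K).
Hypotheses (e0 : (0 < e)%N) (pi0 : pi != 0) (vpi : fval v (i pi) = e%:R^-1)
  (valK : forall x : K, x != 0 -> exists a : int, fval v (i x) = a%:~R / e%:R)
  (frobK : forall x, vge v 0 (i x) ->
    exists y, vge v 0 (i y) /\ vge v e%:R^-1 (i (x - y ^+ p))).
Notation fval := (fval v). Notation vge := (vge v).
Local Notation pi_root := (pi_root i pp pi).
Let p1 : (1 < p)%N := prime_gt1 pp.
Let p0 : (0 < p)%N := prime_gt0 pp.
Let eR0 : 0 < (e%:R : R). Proof. by rewrite ltr0n. Qed.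

(** With s the p-adic valuation of j, z^j has order p^(n+1-s). *)
Lemma val_zeta_pow n (z : L) j : z ^+ (p ^ n.+1) = 1 -> z ^+ (p ^ n) != 1 ->
  (0 < j < p ^ n.+1)%N -> z ^+ j - 1 != 0 /\ fval (z ^+ j - 1) = zval R p n.+1 j.
Proof.
move=> z1 z2 hj; have /andP[j0 _] := hj.
have sn := pfactor_lt pp hj.
have [u cop ju] := pfactor_coprime pp j0.
set s := logn p j in sn ju *.
have [||h1 h2] := @val_unity_root R p L v pp hv vp (n.+1 - s.+1) (z ^+ j).
- rewrite -exprM {1}ju -mulnA -expnD subSS -subSn // subnKC //; last exact: ltnW.
  by rewrite mulnC exprM z1 expr1n.
- apply: contra_neq z2; rewrite -exprM {1}ju -mulnA -expnD subSS subnKC //.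
  rewrite mulnC exprM => h; apply: (pow_coprime_eq1 p0 cop _ h).
  by rewrite -exprM -expnSr.
by rewrite subr_eq0; split.
Qed.

(** Only the automorphism that sends pi_n to a primitive p^n-th root of unity times
    pi_n is used; y_0 is the constant term of y as a polynomial in pi_n. *)
Lemma descent y A : Kinf i pp pi y ->
  (forall s : field_aut i, vge A (s y - y)) ->
  exists y0, vge (A - (p%:R - 1)^-1) (y - i y0).
Proof.
move=> [n [P ->]]; have [Q ->] := tower_expand i pp pi n P.
case: n {P} => [|n] H.
  by exists Q`_0; rewrite big_ord1 expr0 mulr1 subrr; exact: vge0.
have [z [z1 z2]] := prim_root_pow n pp hv vp.
have hx : (z * pi_root n.+1) ^+ (p ^ n.+1) = i pi.
  by rewrite exprMn z1 mul1r pi_root_pow.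
have [||s [_ sx]] := conj_aut (i := i) (f := i) (x := pi_root n.+1) (x' := z * pi_root n.+1) _ alg _.
- by move=> a; exists a.
- by move=> P; exact: (tower_conj hv e0 pi0 vpi valK hx).
have hs := H s.
set N := (p ^ n.+1)%N in Q H hs *.
pose F (j : 'I_N) := i Q`_j * pi_root n.+1 ^+ j * (z ^+ j - 1).
have sF : s (\sum_(j < N) i Q`_j * pi_root n.+1 ^+ j) -
    \sum_(j < N) i Q`_j * pi_root n.+1 ^+ j = \sum_j F j.
  rewrite rmorph_sum -sumrB; apply: eq_bigr => j _.
  rewrite rmorphM rmorphXn /= sx (aut_fix s) exprMn /F; ring.
have Fpos (j : 'I_N) : F j != 0 -> (0 < j < p ^ n.+1)%N.
  move=> Fj; rewrite ltn_ord andbT lt0n; apply/eqP => j0.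
  by move/eqP: Fj; apply; rewrite /F j0 expr0 subrr mulr0.
have valF (j : 'I_N) : F j != 0 -> exists a : int, fval (F j) =
    a%:~R / e%:R + j%:R / (e%:R * (p ^ n.+1)%:R) + zval R p n.+1 j.
  move=> Fj; have hj := Fpos _ Fj; have [zn zv] := val_zeta_pow z1 z2 hj.
  move: Fj; rewrite /F mulf_eq0 negb_or => /andP[h _].
  have [a ha] := val_term pp hv e0 pi0 vpi valK n.+1 j (term_neq0 h).
  by exists a; rewrite (valM hv) // ha zv.
have terms : forall j, xpredT j -> vge A (F j).
  apply: (vge_sum_distinct hv); last by rewrite -sF.
  move=> a b _ _ ab Fa Fb; apply: contra_neq ab => ab.
  have [[c hc] [d hd]] := (valF _ Fa, valF _ Fb).
  apply/val_inj/(twisted_values_distinct pp e0 (Fpos _ Fa) (Fpos _ Fb) (a := c) (a' := d) (R := R)).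
  by rewrite -hc -hd.
exists Q`_0.
have N0 : (0 < N)%N by rewrite expn_gt0 p0.
rewrite (bigD1 (Ordinal N0)) //= expr0 mulr1 addrAC subrr add0r.
apply: (vge_sum hv) => j j0; apply: (vge_valP hv) => nz.
have hj : (0 < j < p ^ n.+1)%N.
  by rewrite ltn_ord andbT lt0n; apply: contra_neq j0 => h; exact/val_inj.
have [zn zv] := val_zeta_pow z1 z2 hj.
move/(vge_val hv _ (mulf_neq0 nz zn)): (terms j isT); rewrite (valM hv) // zv.
have := zval_le R pp n.+1 j; lra.
Qed.

(** If P(x) = 0 then x - y is a root of P(X + y), whose degree does not depend
    on y. *)
Lemma vge_diff_discrete x : exists m : nat, (0 < m)%N /\
  forall y, x - i y != 0 -> exists a : int, fval (x - i y) = a%:~R / m%:R.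
Proof.
have [P P0 Px] := alg x.
exists ((size P)`! * e)%N; split; first by rewrite muln_gt0 fact_gt0.
move=> y xy; pose Q := P \Po ('X + y%:P).
have sQ : size (map_poly i Q) = size P.
  by rewrite size_map_poly size_comp_poly2 ?size_XaddC.
apply: (root_val hv e0 _ _ _ xy (P := map_poly i Q)).
- by rewrite sQ.
- by rewrite -size_poly_eq0 sQ size_poly_eq0.
- rewrite /root map_comp_poly horner_comp rmorphD /= map_polyX map_polyC !hornerE.
  by rewrite subrK.
- by move=> k; rewrite coef_map fmorph_eq0 => /valK.
Qed.

(** Compose the approximation over Kinf, with an arbitrarily small loss eps, with
    the descent to K; then choose eps so that there is no value in (1/m)Z between
    r - eps and r. *)
Lemma ax_optimal_bound x A : (forall s : field_aut i, vge A (s x - x)) ->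
  exists y, vge (A - (p%:R - 1)^-1) (x - i y).
Proof.
move=> H.
have [||| E [f hE]] := @subfield_type L (Kinf i pp pi).
- exact: Kinf1.
- exact: KinfB.
- exact: (Kinf_div alg).
have fi a : exists d, f d = i a.
  by have /hE[d ->] := Kinf_base i pp pi a; exists d.
have frobE a : vge 0 (f a) -> exists t, vge 0 (f t) /\ vge 1 (f a - f t ^+ p).
  move=> a0; have Ea : Kinf i pp pi (f a) by apply/hE; exists a.
  have [_ [/hE[t ->] t0 ht]] := frob_image_Kinf hv vp e0 pi0 vpi valK frobK Ea a0.
  by exists t.
have denseE (a eps : R) : 0 < eps ->
    exists y, [/\ y != 0, a - eps <= fval (f y) & fval (f y) <= a].
  move=> eps0; have [_ [/hE[y ->] y0 h1 h2]] := Kinf_dense pp hv alg e0 pi0 vpi a eps0.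
  by exists y; split=> //; rewrite -(fmorph_eq0 f).
have approx eps : 0 < eps -> exists y, vge (A - (p%:R - 1)^-1 - eps) (x - i y).
  move=> eps0.
  have [||d hd] := ax_ext_eps pp hv vp alg fi frobE denseE (x0 := x) eps0 (z := x) (A := A).
  - by exists 'X; rewrite map_polyX hornerX.
  - by move=> s _; exact: H.
  have [|s|y0 hy0] := @descent (f d) (A - eps).
  - by apply/hE; exists d.
  - have -> : s (f d) - f d = - s (x - f d) + (s x - x) + (x - f d).
      by rewrite rmorphB /=; ring.
    apply: (vgeD hv) => //; apply: (vgeD hv).
      by apply/(vgeN hv); rewrite /vge iso.
    by apply: vge_le (H s); lra.
  exists y0; apply: (vge_trans hv) (_ : vge _ (x - f d)) _.
    by apply: vge_le hd; have := pm1_gt0 R pp; rewrite -invr_gt0; lra.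
  by apply: vge_le hy0; lra.
have [[y xy]|nxy] := pselect (exists y, x = i y).
  by exists y; rewrite xy subrr; exact: vge0.
have nz y : x - i y != 0.
  by rewrite subr_eq0; apply/eqP => h; apply: nxy; exists y.
have [m [m0 hm]] := vge_diff_discrete x.
have mR : 0 < (m%:R : R) by rewrite ltr0n.
set r := A - (p%:R - 1)^-1.
pose a0 := Num.ceil (m%:R * r).
have ha0 : (a0%:~R - 1) / m%:R < r.
  by rewrite ltr_pdivrMr // mulrC; have := ceilB1_lt (m%:R * r); rewrite -/a0 rmorphB.
have ha1 : m%:R * r <= a0%:~R by exact: ceil_ge.
have [|y hy] := approx ((r - (a0%:~R - 1) / m%:R) / 2); first by lra.
exists y; apply/(vge_val hv _ (nz y)); have [a ha] := hm y (nz y).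
move: hy; rewrite (vge_val hv _ (nz y)) ha -/r => hy.
have : (a0%:~R - 1) / m%:R < a%:~R / m%:R :> R by lra.
rewrite ltr_pM2r ?invr_gt0 // -[1]/(1%:~R) -rmorphB /= ltr_int => lt.
rewrite ler_pdivlMr // mulrC; apply: le_trans ha1 _.
by rewrite ler_int; lia.
Qed.

Lemma ax_bound_attained : exists x : L,
  (forall s : field_aut i, vge ((e%:R * p%:R)^-1 + (p%:R - 1)^-1) (s x - x)) /\
  forall r y, vge r (x - i y) -> r <= (e%:R * p%:R)^-1.
Proof.
have vx : fval (pi_root 1) = (e%:R * p%:R)^-1.
  by have := val_pi_root pp hv e0 pi0 vpi 1; rewrite expn1.
have x0 : pi_root 1 != 0 by exact: pi_root_neq0.
have xp : pi_root 1 ^+ p = i pi by have := pi_root_pow i pp pi 1; rewrite expn1.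
exists (pi_root 1); split.
  move=> s; set x := pi_root 1 in x0 xp vx *.
  have sx : (s x / x) ^+ p = 1.
    by rewrite expr_div_n -rmorphXn xp (aut_fix s) divff // fmorph_eq0.
  have -> : s x - x = x * (s x / x - 1) by field.
  apply: (vge_valP hv); rewrite mulf_eq0 negb_or => /andP[_ h].
  rewrite (valM hv) // vx (val_unity_root1 pp hv vp sx) //.
  by rewrite subr_eq0 in h.
move=> r y h; rewrite -vx; apply: (vgeD_neq hv x0 _ h) => y0.
rewrite (valN hv); have y00 : y != 0 by move: y0; rewrite oppr_eq0 fmorph_eq0.
have [a ha] := valK y00; rewrite vx ha; apply/eqP => E.
have := @values_distinct R p pp 1 e 0 a 1 0 e0; rewrite expn1 => D.
suff : 1%N = 0%N by [].
by apply: D => //; rewrite -E !mul0r add0r addr0 mul1r.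
Qed.
End Core.

(** * The completion *)

(** Continuity at 0 gives B such that v(z) >= B implies v(s z) >= 0.  If
    v(s z) < v(z), then for a large power M the element p^q z^M, with q such that its
    value is about B, has an image of negative value. *)
Lemma aut_isometry (R : realType) (p : nat) (K L C : fieldType)
  (i : {rmorphism K -> L}) (j : {rmorphism L -> C}) (v : C -> \bar R)
  (act : field_aut i -> C -> C) :
  is_valuation v -> v p%:R = 1%:E -> acts_by_continuity j v act ->
  forall (s : field_aut i) z, v (j (s z)) = v (j z).
Proof.
move=> hv vp hact s.
have hw : is_valuation (fun z => v (j z)) := is_valuation_comp hv j.
set w := fun z => v (j z) in hw.
have wp : w p%:R = 1%:E by rewrite /w rmorph_nat.
have p0 : (p%:R : L) != 0.
  by apply/eqP => h; move: wp; rewrite h ((valuation_infty hw 0).2 erefl).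
have valp : fval w p%:R = 1 by rewrite /fval wp.
have [B hB] : exists B : R, forall z, vge w B z -> vge w 0 (s z).
  have [cont ext] := hact s; have [B hB] := cont 0 0; exists B => z hz.
  have := hB (j z); rewrite subr0 => /(_ hz).
  by rewrite ext -[X in act s X](rmorph0 j) ext !rmorph0 subr0.
have sz0 z : z != 0 -> s z != 0 by rewrite fmorph_eq0.
have le z : z != 0 -> fval w z <= fval w (s z).
  move=> z0; rewrite leNgt; apply/negP => lt.
  set d := fval w z - fval w (s z).
  have d0 : 0 < d by rewrite subr_gt0.
  pose M := (Num.truncn ((`|B| + 1) / d)).+1.
  have hM : `|B| + 1 < M%:R * d by rewrite -ltr_pdivrMr //; exact: truncnS_gt.
  pose q := Num.ceil (B - M%:R * fval w z).
  have q1 : B - M%:R * fval w z <= q%:~R by exact: ceil_ge.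
  have q2 : q%:~R < B - M%:R * fval w z + 1.
    by have := ceilB1_lt (B - M%:R * fval w z); rewrite -/q rmorphB /=; lra.
  pose y := z ^+ M * p%:R ^ q.
  have y0 : y != 0 by rewrite mulf_neq0 ?expf_neq0 ?expfz_neq0.
  have vy : fval w y = M%:R * fval w z + q%:~R.
    by rewrite (valM hw) ?expf_neq0 ?expfz_neq0 // (valX hw) // (valXz hw) // valp mulr1.
  have sy : s y = s z ^+ M * p%:R ^ q.
    by rewrite rmorphM rmorphXn /= fmorphXz rmorph_nat.
  have vsy : fval w (s y) = M%:R * fval w (s z) + q%:~R.
    rewrite sy (valM hw) ?expf_neq0 ?expfz_neq0 ?sz0 //.
    by rewrite (valX hw) ?sz0 // (valXz hw) // valp mulr1.
  have : vge w 0 (s y) by apply: hB; apply/(vge_val hw) => //; rewrite vy; lra.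
  move/(vge_val hw _ (sz0 _ y0)); rewrite vsy.
  have := ler_norm B; move: hM; rewrite /d; lra.
move=> z; have [->|z0] := eqVneq z 0; first by rewrite !rmorph0.
have e : fval w (s z) = fval w z.
  apply/eqP; rewrite eq_le le // andbT.
  have zi : z^-1 != 0 by rewrite invr_eq0.
  have := le _ zi; rewrite fmorphV !(valV hw) ?sz0 //; lra.
by have := v_fin hw (sz0 _ z0); have := v_fin hw z0; rewrite /w e => -> ->.
Qed.

Theorem mainTheorem2 (R : realType) (p : nat) (k : fieldType)
    (W : idomainType) (coord : W -> nat -> k)
    (K : fieldExtType {fraction W}) (Kbar : closedFieldType)
    (i : {rmorphism K -> Kbar}) (C : fieldType) (j : {rmorphism Kbar -> C})
    (v : C -> \bar R) (act : field_aut i -> C -> C)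
    (p_prime : prime p)
    (k_perfect : perfect_field p k)
    (W_witt : is_witt_ring p coord)
    (Kbar_algebraic : forall z : Kbar, algebraicOver i z)
    (C_completion : is_completion j v)
    (v_extends : is_padic_valuation p (fun a : {fraction W} => v (j (i a%:A))))
    (K_totally_ramified : totally_ramified (fun x : K => v (j (i x))))
    (act_continuity : acts_by_continuity j v act) :
  ax_property j v act (p%:R - 1)^-1 /\
  forall c : R, ax_property j v act c -> (p%:R - 1)^-1 <= c.
Proof.
have hv := compl_val C_completion.
have hw : is_valuation (fun z => v (j z)) := is_valuation_comp hv j.
have hvK : is_valuation (fun x => v (j (i x))) := is_valuation_comp hw i.
have vp : v p%:R = 1%:E.
  by case: v_extends => _ + _; rewrite scaler_nat !rmorph_nat.
have wp : v (j p%:R) = 1%:E by rewrite rmorph_nat.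
have iso := aut_isometry hv vp act_continuity.
have vKp : v (j (i p%:R)) = 1%:E by rewrite !rmorph_nat.
have [m [m0 hm]] := val_ext_denom p_prime k_perfect W_witt hvK v_extends.
have [e [pi [e0 pi0 vpi valK]]] := uniformizerP hvK m0 vKp hm.
have frobK := residue_field_perfect p_prime k_perfect W_witt hvK v_extends
  K_totally_ramified e0 pi0 vpi valK.
split.
  move=> x A xA.
  have [z xz] := compl_dense C_completion x A.
  have [s|y hy] := ax_optimal_bound p_prime hw wp Kbar_algebraic iso e0 pi0 vpi valK frobK
    (x := z) (A := A).
    have [cont ext] := act_continuity s; have [B hB] := cont x A.
    have [z' xz'] := compl_dense C_completion x (Num.max A B).
    have hA : vge v A (x - j z') by apply: vge_le xz'; rewrite le_max lexx.
    have hzz' : vge v A (j z' - j z).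
      by apply: (vge_trans hv (y := x)) => //; exact: vgeBC.
    have h1 : vge v A (act s (j z') - act s x).
      by apply/hB/(vgeBC hv)/(vge_le _ xz'); rewrite le_max lexx orbT.
    have h2 : vge v A (j (s z) - j (s z')).
      by apply/(vgeBC hv); rewrite -!rmorphB /vge /= iso rmorphB.
    rewrite /vge rmorphB.
    apply: (vge_trans hv h2); rewrite -ext.
    apply: (vge_trans hv h1); apply: (vge_trans hv (xA s)).
    exact: xz.
  exists y; have hy' : vge v (A - (p%:R - 1)^-1) (j z - j (i y)) by rewrite -rmorphB.
  apply: (vge_trans hv _ hy'); apply: vge_le xz.
  by have := pm1_gt0 R p_prime; rewrite -invr_gt0; lra.
move=> c hc.
have [x [h1 h2]] := ax_bound_attained p_prime hw wp e0 pi0 vpi valK.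
have [s|y hy] := hc (j x) ((e%:R * p%:R)^-1 + (p%:R - 1)^-1).
  by have [_ ->] := act_continuity s; rewrite -rmorphB; exact: h1.
have := h2 (((e%:R * p%:R)^-1 + (p%:R - 1)^-1) - c) y.
rewrite /vge rmorphB => /(_ hy); lra.
Qed.
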